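(* Let $g\ge3$, let $\widetilde f:\mathcal L\to\mathcal L$ be a lift under $q_g$ of a pseudo-Anosov homeomorphism $f:S_g\to S_g$, and let $\widetilde A$ be the matrix related to the symbolic coding of $(\mathcal L,\widetilde f)$. If $\widetilde A$ is irreducible, then $\widetilde A$ is either transient or null recurrent.
   Context: Cover. $S_g$ is the closed connected orientable surface of genus $g$. $\mathcal L$ is the infinite Jacob's ladder surface (the connected orientable surface without boundary, of infinite genus, with exactly two ends, both non-planar). $h_{g-1}$ is the standard handle shift homeomorphism of $\mathcal L$ by $g-1$ handles, and $q_g:\mathcal L\to S_g$ is the regular cover with deck group $\langle h_{g-1}\rangle\cong\mathbb Z$; concretely, cut $S_g$ along a nonseparating simple closed curve to get a surface of genus $g-1$ with two boundary components, glue $\mathbb Z$ copies of it end to end to form $\mathcal L$, and let $h_{g-1}$ shift each copy to the next. A lift of $f$ is a homeomorphism $\widetilde f$ of $\mathcal L$ with $q_g\widetilde f=fq_g$. Markov partition. A pseudo-Anosov $f$ preserves transverse singular measured foliations $\mathcal F_s,\mathcal F_u$, multiplying the unstable transverse measure by the stretch factor $\lambda>1$ and the stable one by $\lambda^{-1}$. A good birectangle is an embedded $[0,1]\times[0,1]$ whose sides lie alternately in stable and unstable leaves, opposite sides being disjoint and in leaves of the same foliation; $\mathcal F^{s}(x,R),\mathcal F^{u}(x,R)$ are the stable/unstable segments of $R$ through $x$. A finite Markov partition of $(S_g,f)$ is a finite set $\mathcal R=\{R_1,\dots,R_m\}$ of good birectangles with disjoint interiors covering $S_g$ such that whenever $x\in\operatorname{int}R_i$,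 $f(x)\in\operatorname{int}R_j$: $f(\mathcal F^s(x,R_i))\subset\mathcal F^s(f(x),R_j)$, $f^{-1}(\mathcal F^u(f(x),R_j))\subset\mathcal F^u(x,R_i)$, $f(\mathcal F^u(x,R_i))\cap R_j=\mathcal F^u(f(x),R_j)$ and $f^{-1}(\mathcal F^s(f(x),R_j))\cap R_i=\mathcal F^s(x,R_i)$. Such partitions exist (Thurston). Its transition matrix $A$ is the $m\times m$ $0$-$1$ matrix with $A_{\alpha\beta}=1$ iff $f(\operatorname{int}R_\alpha)\cap\operatorname{int}R_\beta\ne\emptyset$; it is irreducible and aperiodic with Perron eigenvalue $\lambda$. Symbolic coding of $(\mathcal L,\widetilde f)$. For each $i$ choose a connected set $R_{(i,0)}\subset q_g^{-1}(R_i)$ mapped bijectively onto $R_i$ by $q_g$, so that $K_0=\bigcup_iR_{(i,0)}$ is connected; put $R_{(i,j)}=h_{g-1}^j(R_{(i,0)})$ for $j\in\mathbb Z$. The matrix $\widetilde A$ is the $0$-$1$ matrix indexed by $\{1,\dots,m\}\times\mathbb Z$ with $\widetilde A_{(i_1,j_1)(i_2,j_2)}=1$ iff $\widetilde f(\operatorname{int}R_{(i_1,j_1)})\cap\operatorname{int}R_{(i_2,j_2)}\neq\emptyset$. Matrix terminology. A non-negative matrix $B$ indexed by a countable set is irreducible if for all indices $a,b$ there is $N\ge1$ with $(B^N)_{ab}>0$. With $\lambda>1$ the stretch factor of the pseudo-Anosov homeomorphism $f$ (equivalently, the Perron eigenvalue of the transition matrix $A$ of the finite Markov partition $\mathcal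 R$ of $(S_g,f)$), and $(\widetilde A^n)^*_{aa}$ the number of closed paths of length $n$ at $a$ in the directed graph of $\widetilde A$ that return to $a$ for the first time at step $n$: the irreducible matrix $\widetilde A$ is recurrent if $\sum_{n\ge0}(\widetilde A^n)_{aa}\lambda^{-n}=\infty$ and transient if this sum is finite; a recurrent $\widetilde A$ is positive recurrent if $\sum_{n\ge1}n(\widetilde A^n)^*_{aa}\lambda^{-n}<\infty$ and null recurrent if this sum is infinite. *)

(* Defs.v *)
From HB Require Import structures.
From Stdlib Require Import Relation_Operators.
From mathcomp Require Import all_boot all_order all_algebra.
From mathcomp Require Import all_classical all_reals all_analysis.
From mathcomp.real_closed Require Import complex.

Set Implicit Arguments.
Unset Strict Implicit.
Unset Printing Implicit Defensive.
Import Order.TTheory GRing.Theory Num.Theory.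
Import numFieldNormedType.Exports.

Local Open Scope classical_set_scope.
Local Open Scope ring_scope.

Record homeo (X Y : topologicalType) := Homeo {
  homeo_fun :> X -> Y;
  homeo_inv : Y -> X;
  homeo_funK : cancel homeo_fun homeo_inv;
  homeo_invK : cancel homeo_inv homeo_fun;
  homeo_fun_cont : continuous homeo_fun;
  homeo_inv_cont : continuous homeo_inv
}.

Definition zpow (X : topologicalType) (h : homeo X X) (j : int) : X -> X :=
  match j with
  | Posz n => iter n h
  | Negz n => iter n.+1 (homeo_inv h)
  end.

(* [f] restricts to a homeomorphism of the open set [U] onto an open set. *)
Definition open_embedding (X Y : topologicalType) (U : set X) (f : X -> Y) :=
  [/\ open U, {in U &, injective f}, {in U, continuous f} &
      forall V, open V -> V `<=` U -> open (f @` V)].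

(** * The closed surface of genus g *)

Section Surface.
Context {R : realType}.

Definition unit_disc : set (R * R) := [set z | z.1 ^+ 2 + z.2 ^+ 2 <= 1].

(* The point at parameter [t] of the [k]-th side of the disc seen as a 4g-gon
   with sides of equal length on the unit circle. *)
Definition side_point (g k : nat) (t : R) : R * R :=
  let theta := 2 * pi * (k%:R + t) / (4 * g)%:R in (cos theta, sin theta).

(* The boundary word is the product of the a_k b_k a_k^-1 b_k^-1, k < g. *)
Inductive side_gluing (g : nat) : R * R -> R * R -> Prop :=
| GlueA k t : (k < g)%N -> 0 <= t <= 1 ->
    side_gluing g (side_point g (4 * k)%N t) (side_point g (4 * k + 2)%N (1 - t))
| GlueB k t : (k < g)%N -> 0 <= t <= 1 ->
    side_gluing g (side_point g (4 * k + 1)%N t)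
                  (side_point g (4 * k + 3)%N (1 - t)).

(* For g >= 1.  The disc being compact and [S] Hausdorff, [p] is a quotient
   map, so that [S] is homeomorphic to the polygon with its sides identified. *)
Definition closed_surface (g : nat) (S : topologicalType) :=
  hausdorff_space S /\
  exists p : R * R -> S,
    [/\ {within unit_disc, continuous p}, p @` unit_disc = setT &
        forall z w, unit_disc z -> unit_disc w ->
          (p z = p w <-> clos_refl_sym_trans (R * R)%type (side_gluing g) z w)].

Definition simple_closed_curve (S : topologicalType) (C : set S) :=
  exists c : R -> S,
    [/\ {within `[0, 1], continuous c}, c 0 = c 1,
        {in `[0, 1[ &, injective c} & c @` `[0, 1] = C].

End Surface.

(** * The infinite cyclic cover by the ladder *)

Definition covering (L S : topologicalType) (q : L -> S) :=
  [/\ continuous q, range q = setT &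
      forall s, exists U : set S, exists sheets : set (set L),
        [/\ open U, U s, q @^-1` U = \bigcup_(V in sheets) V,
            trivIset sheets id &
            forall V, sheets V -> open_embedding V q /\ q @` V = U]].

(* The deck group is <h>, infinite cyclic, and transitive on fibres. *)
Definition regular_Z_cover (L S : topologicalType) (q : L -> S)
    (h : homeo L L) :=
  [/\ covering q,
      forall phi : homeo L L,
        (forall x, q (phi x) = q x) <-> (exists j, phi =1 zpow h j),
      forall x y, q x = q y -> exists j, y = zpow h j x &
      forall j, zpow h j =1 id -> j = 0].

(* [L] is obtained by gluing end to end the translates by the powers of [h] of
   one copy [M] of [S] cut along the nonseparating curve [C]: the two boundary
   components of [M] are its intersections with [h M] and [h^-1 M], they are
   copies of [C], and the rest of [M] is a copy of the complement of [C]. *)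
Definition ladder_cover (R : realType) (L S : topologicalType) (q : L -> S)
    (h : homeo L L) :=
  [/\ connected [set: L], regular_Z_cover q h &
    exists C : set S, exists M : set L,
      [/\ simple_closed_curve (R := R) C /\ connected (~` C),
          compact M /\ connected M,
          \bigcup_(j in [set: int]) (zpow h j @` M) = setT /\
            (forall j : int, 2 <= `|j| -> M `&` (zpow h j @` M) = set0),
          set_bij (M `&` (h @` M)) C q /\
            set_bij (M `\` (q @^-1` C)) (~` C) q &
          M `&` (q @^-1` C) =
            (M `&` (h @` M)) `|` (M `&` (homeo_inv h @` M))]].

Definition is_lift (L S : topologicalType) (q : L -> S) (f : S -> S)
    (ft : L -> L) :=
  forall x, q (ft x) = f (q x).

(** * Pseudo-Anosov homeomorphisms *)

Section Foliations.
Context {R : realType} {S : topologicalType}.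

(* Near [p], [psi - psi p] is [phi - phi p] with its first coordinate multiplied
   by a or -a and its second one by b or -b. *)
Definition diag_near (a b : R) (phi psi : S -> R * R) (p : S) :=
  exists e d : bool, \forall z \near p,
    (psi z).1 - (psi p).1 = (-1) ^+ e * a * ((phi z).1 - (phi p).1) /\
    (psi z).2 - (psi p).2 = (-1) ^+ d * b * ((phi z).2 - (phi p).2).

Definition toC (z : R * R) : R[i] := Complex z.1 z.2.

(* A transverse pair (F_s, F_u) of singular measured foliations, by an atlas of
   natural charts (x, y) on the complement of the singularities.  The leaves of
   F_s are locally the curves {y = constant} and its transverse measure is |dy|;
   those of F_u are locally the curves {x = constant}, with transverse measure
   |dx|.  At a singularity both foliations have k >= 3 prongs: there is a chart
   [zeta] centred there in which they are those of the real and imaginary parts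
   of the local branches of w = zeta^(k/2). *)
Record bifoliation := Bifoliation {
  sing : set S;
  charts : set (set S * (S -> R * R));
  sing_finite : finite_set sing;
  chart_embedding : forall U phi, charts (U, phi) ->
    open_embedding U phi /\ U `<=` ~` sing;
  chart_cover : forall p, ~ sing p -> exists U phi, charts (U, phi) /\ U p;
  chart_transition : forall U phi V psi p,
    charts (U, phi) -> charts (V, psi) -> U p -> V p ->
    diag_near 1 1 phi psi p;
  sing_prongs : forall p, sing p ->
    exists (k : nat) (W : set S) (zeta : S -> R * R),
      [/\ (3 <= k)%N, W p, open_embedding W zeta, zeta p = (0, 0) &
        forall z0 U phi, W z0 -> charts (U, phi) -> U z0 ->
          exists w : S -> R * R,
            [/\ {for z0, continuous w},
                \forall z \near z0, toC (w z) ^+ 2 = toC (zeta z) ^+ k &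
                diag_near 1 1 w phi z0]]
}.

(* f_* multiplies the transverse measure of F_u by lambda and that of F_s by
   1/lambda, where f_* mu is mu o f^-1 on arcs.  So f multiplies |dx| by
   1/lambda and |dy| by lambda: it contracts the leaves of F_s and stretches
   those of F_u. *)
Definition pseudo_anosov (F : bifoliation) (lambda : R) (f : homeo S S) :=
  [/\ 1 < lambda,
      forall p, sing F (f p) <-> sing F p &
      forall U phi V psi p, charts F (U, phi) -> charts F (V, psi) ->
        U p -> V (f p) -> diag_near lambda^-1 lambda phi (psi \o f) p].

(* A path on [0, 1] contained in a leaf; [c] is the transverse coordinate, so
   [snd] for F_s and [fst] for F_u.  The leaf through a singularity contains all
   of its prongs, so there is no condition at the times where [gamma] is
   singular. *)
Definition leaf_path (F : bifoliation) (c : R * R -> R) (gamma : R -> S) :=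
  {within `[0, 1], continuous gamma} /\
  forall U phi t, charts F (U, phi) -> 0 <= t <= 1 -> U (gamma t) ->
    \forall s \near t, 0 <= s <= 1 -> c (phi (gamma s)) = c (phi (gamma t)).

Definition unit_square : set (R * R) :=
  [set z | (0 <= z.1 <= 1) /\ (0 <= z.2 <= 1)].

(** * Markov partitions *)

(* Horizontal segments run along stable leaves and vertical ones along unstable
   leaves; in particular the sides do. *)
Definition good_birectangle (F : bifoliation) (rho : R * R -> S) :=
  [/\ {within unit_square, continuous rho},
      {in unit_square &, injective rho},
      forall b, 0 <= b <= 1 -> leaf_path F snd (fun s => rho (s, b)) &
      forall a, 0 <= a <= 1 -> leaf_path F fst (fun s => rho (a, s))].

Definition rect (rho : R * R -> S) : set S := rho @` unit_square.

Definition stable_seg (rho : R * R -> S) (x : S) : set S :=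
  [set y | exists a b s, [/\ unit_square (a, b), 0 <= s <= 1,
                             x = rho (a, b) & y = rho (s, b)]].

Definition unstable_seg (rho : R * R -> S) (x : S) : set S :=
  [set y | exists a b s, [/\ unit_square (a, b), 0 <= s <= 1,
                             x = rho (a, b) & y = rho (a, s)]].

Definition markov_partition (F : bifoliation) (f : S -> S) (m : nat)
    (rho : 'I_m -> R * R -> S) :=
  [/\ forall i, good_birectangle F (rho i),
      forall i j, i != j -> (rect (rho i))° `&` (rect (rho j))° = set0,
      \bigcup_(i in [set: 'I_m]) rect (rho i) = setT &
      forall i j x, (rect (rho i))° x -> (rect (rho j))° (f x) ->
        [/\ f @` stable_seg (rho i) x `<=` stable_seg (rho j) (f x),
            f @^-1` unstable_seg (rho j) (f x) `<=` unstable_seg (rho i) x,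
            f @` unstable_seg (rho i) x `&` rect (rho j)
              = unstable_seg (rho j) (f x) &
            f @^-1` stable_seg (rho j) (f x) `&` rect (rho i)
              = stable_seg (rho i) x]].

End Foliations.

Arguments bifoliation : clear implicits.

(** * Symbolic coding of the lift *)

Section Coding.
Context {R : realType} {L S : topologicalType} (q : L -> S) (h : homeo L L).
Context {m : nat} (rho : 'I_m -> R * R -> S) (R0 : 'I_m -> set L).

Definition lifted_rectangles :=
  (forall i, connected (R0 i) /\ set_bij (R0 i) (rect (rho i)) q) /\
  connected (\bigcup_(i in [set: 'I_m]) R0 i).

Definition lifted_rect (a : 'I_m * int) : set L := zpow h a.2 @` R0 a.1.

End Coding.

Definition coding_matrix (R : realType) (L : topologicalType) (ft : L -> L)
    (h : homeo L L) (m : nat) (R0 : 'I_m -> set L) (a b : 'I_m * int) : R :=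
  `[< (ft @` (lifted_rect h R0 a)°) `&` (lifted_rect h R0 b)° !=set0 >]%:R.

(** * Countable non-negative matrices *)

Section Matrices.
Context {R : realType} {I : countType}.
Local Open Scope ereal_scope.

Fixpoint mxpow (B : I -> I -> R) (n : nat) (a b : I) : \bar R :=
  if n is n'.+1 then \esum_(c in [set: I]) ((B a c)%:E * mxpow B n' c b)
  else (a == b)%:R%:E.

Definition irreducible_mx (B : I -> I -> R) :=
  forall a b, exists2 N, (1 <= N)%N & 0 < mxpow B N a b.

(* The successive vertices, after [a], of a closed path of length [n] at [a] in
   the directed graph of [B] that returns to [a] for the first time at step
   [n]; for n >= 1. *)
Definition first_return_paths (B : I -> I -> R) (n : nat) (a : I) :
    set (seq I) :=
  [set p | [/\ path (fun c d => B c d != 0%R) a p, size p = n, last a p = a &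
               a \notin behead (belast a p)]].

Definition first_return_count (B : I -> I -> R) (n : nat) (a : I) : \bar R :=
  \esum_(p in first_return_paths B n a) 1.

Definition return_series (lambda : R) (B : I -> I -> R) (a : I) : \bar R :=
  \sum_(0 <= n <oo) (mxpow B n a a * (lambda ^- n)%:E).

Definition mean_return_series (lambda : R) (B : I -> I -> R) (a : I) :
    \bar R :=
  \sum_(1 <= n <oo) (n%:R%:E * first_return_count B n a * (lambda ^- n)%:E).

Definition recurrent (lambda : R) (B : I -> I -> R) :=
  forall a, return_series lambda B a = +oo.

Definition transient (lambda : R) (B : I -> I -> R) :=
  forall a, return_series lambda B a < +oo.

Definition null_recurrent (lambda : R) (B : I -> I -> R) :=
  recurrent lambda B /\ forall a, mean_return_series lambda B a = +oo.

End Matrices.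

(* Main.v *)
Require Import Defs.
From mathcomp Require Import all_boot all_order all_algebra.
From mathcomp Require Import finmap.
From mathcomp Require Import lra.
From mathcomp Require Import all_classical all_reals all_analysis.

(** Let B be the coding matrix of the lift ft, a 0-1 matrix indexed by pairs of a
    rectangle and an integer.  Two properties of B carry the proof.

    - B is invariant under the shift of the integers, up to a sign: ft conjugates
      the generator h of the deck group to h or to its inverse, so that B is
      unchanged when its first index is shifted by k and the second one by e * k,
      with e = 1 or e = -1 ([lift_conj_shift], [coding_matrix_shift]).
    - There are heights H > 0, which depend on the rectangle only, such that
      \sum_b B a b * H b <= lambda * H a ([coding_row_sum]).  The height of a
      rectangle is the infimum of the lengths, for the transverse measure of the
      stable foliation, of its verticals that avoid the singularities.  Such a
      vertical is stretched by the factor lambda, and its image crosses a full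
      vertical of R_j for each transition from R_i to R_j; these crossings do not
      overlap, so that their lengths add up ([crossing_sum]).  A transition comes
      from at most one edge at a given index, because a square lifts to the cover
      and a connected set over a rectangle stays in one sheet ([edge_unique]).

    The rest is about Markov chains: B a b * H b / (lambda * H a) is a
    substochastic matrix.  If B is recurrent for lambda, the renewal equation
    shows that the return probabilities have sum 1.  If moreover the mean return
    time to a is finite, the expected numbers of visits during an excursion from a
    give a left eigenvector p of B for lambda, with \sum_b p b * H b finite
    ([occupation_summable], [occupation_invariant]).  The sum nu of its translates
    is finite, and is a left eigenvector as well.  The ratio p / nu tends to 0 at
    infinity, so has a maximum; there, irreducibility propagates the equality
    p = c * nu to all indices.  So p is invariant under translations, which
    contradicts that it is summable ([no_finite_invariant]). *)

Set Implicit Arguments.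
Unset Strict Implicit.
Unset Printing Implicit Defensive.
Import Order.TTheory GRing.Theory Num.Theory.
Import numFieldNormedType.Exports.
Local Open Scope classical_set_scope.
Local Open Scope ring_scope.

(** * Unconditional sums *)

Section EsumExtra.
Context {R : realType}.
Local Open Scope ereal_scope.

Lemma esum_ge_term (T : choiceType) (D : set T) (a : T -> \bar R) x :
  (forall i, D i -> 0 <= a i) -> D x -> a x <= \esum_(i in D) a i.
Proof.
move=> a0 Dx; apply: esum_ge; exists [set x].
  by split; [exact: finite_set1 | move=> y ->].
by rewrite fsbig_set1.
Qed.

Lemma esumZl (T : choiceType) (D : set T) (c : \bar R) (a : T -> \bar R) :
  0 <= c -> (forall i, D i -> 0 <= a i) ->
  \esum_(i in D) (c * a i) = c * \esum_(i in D) a i.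
Proof.
have le_fin (r : R) (b : T -> \bar R) : (0 <= r)%R ->
    (forall i, D i -> 0 <= b i) ->
    \esum_(i in D) (r%:E * b i) <= r%:E * \esum_(i in D) b i.
  move=> r0 b0; apply: ge_ereal_sup => /= _ [X [finX XD] <-].
  rewrite fsbig_finite//= big_seq -ge0_sume_distrr; last first.
    by move=> i; rewrite in_fset_set// inE => /XD/b0.
  apply: lee_wpmul2l; first by rewrite lee_fin.
  by rewrite -big_seq -fsbig_finite//; apply: ereal_sup_ubound; exists X.
move=> c0 a0; case: c c0 => [r r0| _|//].
  move: r0; rewrite lee_fin le_eqVlt => /predU1P[<-|r0].
    by rewrite mul0e esum1// => i _; rewrite mul0e.
  apply/eqP; rewrite eq_le le_fin ?(ltW r0)//=.
  have r0' : 0 <= r%:E by rewrite lee_fin ltW.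
  have ra0 i : D i -> 0 <= r%:E * a i by move=> /a0 ?; rewrite mule_ge0.
  have rV0 : (0 <= r^-1)%R by rewrite invr_ge0 ltW.
  have -> : \esum_(i in D) a i = \esum_(i in D) (r^-1%:E * (r%:E * a i)).
    by apply: eq_esum => i _; rewrite muleA -EFinM mulVf ?gt_eqF// mul1e.
  apply: (le_trans (lee_wpmul2l r0' (le_fin _ _ rV0 ra0))).
  by rewrite muleA -EFinM divff ?gt_eqF// mul1e.
have [all0|/existsNP[x /not_implyP[Dx /eqP ax]]] :=
  pselect (forall i, D i -> a i = 0).
  by rewrite !esum1 ?mule0// => i Di; rewrite all0// mule0.
have ax0 : 0 < a x by rewrite lt0e ax a0.
rewrite gt0_mulye; last by rewrite (lt_le_trans ax0)// esum_ge_term.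
have := @esum_ge_term _ D (fun i => +oo * a i) x.
rewrite gt0_mulye// leye_eq => le_x; apply/eqP/le_x => // i Di.
by rewrite mule_ge0// a0.
Qed.

Lemma esumZr (T : choiceType) (D : set T) (c : \bar R) (a : T -> \bar R) :
  0 <= c -> (forall i, D i -> 0 <= a i) ->
  \esum_(i in D) (a i * c) = (\esum_(i in D) a i) * c.
Proof.
by move=> c0 a0; rewrite muleC -esumZl//; apply: eq_esum => i _; rewrite muleC.
Qed.

Lemma esum_exchange (T U : choiceType) (a : T -> U -> \bar R) :
  (forall i j, 0 <= a i j) ->
  \esum_(i in [set: T]) \esum_(j in [set: U]) a i j =
  \esum_(j in [set: U]) \esum_(i in [set: T]) a i j.
Proof.
move=> a0; rewrite !esum_esum//.
apply: (@reindex_esum R _ _ _ _ (fun x => (x.2, x.1)) (fun k => a k.1 k.2)).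
split=> //=; first by move=> [i1 i2] [j1 j2] _ _ [] -> ->.
by move=> [i j] _; exists (j, i).
Qed.

Lemma finite_esum_ge (T : choiceType) (a : T -> \bar R) (d : R) :
  (forall i, 0 <= a i) -> \esum_(i in [set: T]) a i < +oo -> (0 < d)%R ->
  finite_set [set i | d%:E <= a i].
Proof.
move=> a0 afin d0; apply: contrapT => inf.
have Sfin : \esum_(i in [set: T]) a i \is a fin_num.
  by rewrite ge0_fin_numE// esum_ge0.
have S0 : (0 <= fine (\esum_(i in [set: T]) a i))%R by rewrite fine_ge0// esum_ge0.
set s := fine _ in S0; pose n := Num.bound (s / d).
have [X XA cX] := infinite_set_fset n inf.
have : \sum_(i \in [set` X]) a i <= s%:E.
  rewrite /s fineK//; apply: ereal_sup_ubound; exists [set` X] => //.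
apply/negP; rewrite -ltNge fsbig_finite//= set_fsetK.
apply: (@lt_le_trans _ _ (\sum_(i <- X) d%:E)); last first.
  by rewrite big_seq [leRHS]big_seq; apply: lee_sum => i iX; apply: XA.
rewrite sumEFin lte_fin big_const_seq count_predT iter_addr_0.
have : (s / d < n%:R)%R by rewrite archi_boundP// divr_ge0// ltW.
rewrite ltr_pdivrMr// => /lt_le_trans; apply.
by rewrite -[leRHS]mulr_natl ler_wpM2r ?(ltW d0)// ler_nat.
Qed.

Lemma esum_nat_recl (a : nat -> \bar R) : (forall n, 0 <= a n) ->
  \esum_(n in [set: nat]) a n = a 0%N + \esum_(n in [set: nat]) a n.+1.
Proof.
move=> a0; rewrite (esumID [set 0%N])//; congr (_ + _).
  by rewrite setTI esum_set1.
rewrite setTI; apply: (@reindex_esum R _ _ _ _ S a); split => /=.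
- by [].
- by move=> x y _ _ [].
- by move=> [|n] //= _; exists n.
Qed.

End EsumExtra.

(** * First passages and renewal *)

Section FirstPassage.
Context {R : realType} {I : countType}.
Variable B : I -> I -> R.
Hypothesis B_ge0 : forall a b, 0 <= B a b.
Local Open Scope ereal_scope.

Let EB_ge0 a b : 0 <= (B a b)%:E.
Proof. by rewrite lee_fin. Qed.

(** The paths of length n.+1 from c that reach a for the first time at their
    end; the shift of the index excludes the empty path. *)
Fixpoint first_passage (a : I) (n : nat) (c : I) : \bar R :=
  if n is n'.+1 then
    \esum_(d in [set: I]) (if d == a then 0 else (B c d)%:E * first_passage a n' d)
  else (B c a)%:E.

(** The paths of length n from a to b that avoid a after time 0.  The recursion
    is on the last step, whereas that of [first_passage] is on the first one, so
    that the two can be concatenated. *)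
Fixpoint taboo (a : I) (n : nat) (b : I) : \bar R :=
  if n is n'.+1 then
    if b == a then 0 else \esum_(c in [set: I]) (taboo a n' c * (B c b)%:E)
  else (b == a)%:R%:E.

Lemma mxpow_ge0 n a b : 0 <= mxpow B n a b.
Proof.
elim: n a => [|n IH] a /=; first by rewrite lee_fin ler0n.
by apply: esum_ge0 => c _; rewrite mule_ge0.
Qed.

Lemma first_passage_ge0 a n c : 0 <= first_passage a n c.
Proof.
elim: n c => [|n IH] c //=; apply: esum_ge0 => d _.
by case: ifP => // _; rewrite mule_ge0.
Qed.

Lemma taboo_ge0 a n b : 0 <= taboo a n b.
Proof.
elim: n b => [|n IH] b /=; first by rewrite lee_fin ler0n.
by case: ifP => // _; apply: esum_ge0 => d _; rewrite mule_ge0.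
Qed.

Lemma esum_delta (a : I) (F : I -> \bar R) : 0 <= F a ->
  \esum_(c in [set: I]) ((c == a)%:R%:E * F c) = F a.
Proof.
move=> Fa; rewrite -(@esum_set1 _ _ a F)// [RHS]esum_mkcond; apply: eq_esum => c _.
have [->|ca] := eqVneq c a; first by rewrite mem_set// mul1e.
by rewrite memNset ?mul0e// => /= /eqP; exact/negP.
Qed.

Lemma mxpowD m n a b :
  mxpow B (m + n) a b = \esum_(c in [set: I]) (mxpow B m a c * mxpow B n c b).
Proof.
elim: m a => [|m IH] a.
  rewrite add0n -(@esum_delta a (fun c => mxpow B n c b)) ?mxpow_ge0//.
  by apply: eq_esum => c _; rewrite /= eq_sym.
rewrite addSn /=; under eq_esum do rewrite IH.
transitivity (\esum_(c in [set: I]) \esum_(d in [set: I])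
    ((B a c)%:E * (mxpow B m c d * mxpow B n d b))).
  by apply: eq_esum => c _; rewrite esumZl// => d _; rewrite mule_ge0// mxpow_ge0.
rewrite esum_exchange; last by move=> c d; rewrite !mule_ge0// mxpow_ge0.
apply: eq_esum => d _; rewrite -esumZr ?mxpow_ge0//; last first.
  by move=> c _; rewrite mule_ge0// mxpow_ge0.
by apply: eq_esum => c _; rewrite muleA.
Qed.

(** A first return to a is cut after its k-th step. *)
Lemma taboo_first_passage a k n :
  \esum_(c in [set: I]) (taboo a k c * first_passage a n c) =
  first_passage a (k + n) a.
Proof.
elim: k n => [|k IH] n; first exact/esum_delta/first_passage_ge0.
rewrite addSnnS -IH /=.
transitivity (\esum_(d in [set: I]) \esum_(c in [set: I])
   (if d == a then 0 else taboo a k c * ((B c d)%:E * first_passage a n d))).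
  apply: eq_esum => d _; case: ifP => _; first by rewrite mul0e esum1.
  rewrite -esumZr ?first_passage_ge0//; last first.
    by move=> c _; rewrite mule_ge0 ?taboo_ge0.
  by apply: eq_esum => c _; rewrite muleA.
rewrite esum_exchange; last first.
  by move=> d c; case: ifP => // _; rewrite !mule_ge0 ?taboo_ge0 ?first_passage_ge0.
apply: eq_esum => c _; rewrite -esumZl ?taboo_ge0//; last first.
  by move=> d _; case: ifP => // _; rewrite !mule_ge0 ?first_passage_ge0.
by apply: eq_esum => d _; case: ifP => // _; rewrite mule0.
Qed.

(** Renewal: a path to a is cut at its first visit to a. *)
Lemma mxpow_first_passage a n c :
  mxpow B n.+1 c a = \sum_(k < n.+1) first_passage a k c * mxpow B (n - k) a a.
Proof.
elim: n c => [|n IH] c.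
  rewrite big_ord1 subnn /= eqxx mule1.
  rewrite -(@esum_delta a (fun d => (B c d)%:E))//.
  by apply: eq_esum => d _; rewrite muleC.
rewrite big_ord_recl subn0 /=.
under [X in _ = _ + X]eq_bigr => k _ do rewrite /bump /= add1n subSS.
transitivity (\esum_(d in [set: I]) ((d == a)%:R%:E * ((B c d)%:E * mxpow B n.+1 d a) +
   \sum_(k < n.+1) (if d == a then 0 else (B c d)%:E * first_passage a k d) *
       mxpow B (n - k) a a)).
  apply: eq_esum => d _; have [->|da] := eqVneq d a.
    rewrite mul1e big1 ?adde0// => k _.
    by rewrite mul0e.
  rewrite mul0e add0e -/(mxpow B n.+1 d a) IH ge0_sume_distrr.
    by apply: eq_bigr => k _; rewrite muleA.
  by move=> k _; rewrite mule_ge0 ?first_passage_ge0 ?mxpow_ge0.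
have ge0 k d : 0 <= (if d == a then 0 else (B c d)%:E * first_passage a k d).
  by case: ifP => // _; rewrite mule_ge0 ?first_passage_ge0.
rewrite esumD; first last.
- by move=> d _; apply: sume_ge0 => k _; rewrite mule_ge0 ?mxpow_ge0.
- by move=> d _; rewrite !mule_ge0 ?mxpow_ge0 ?lee_fin ?ler0n.
rewrite esum_delta ?mule_ge0 ?mxpow_ge0//; congr (_ + _).
rewrite esum_sum; last by move=> d k _ _; rewrite mule_ge0 ?mxpow_ge0.
by apply: eq_bigr => k _; rewrite esumZr// mxpow_ge0.
Qed.

(** The weight of a path is 0 or 1, and removing its first vertex matches the
    recursion of [first_passage]. *)
Lemma first_return_countE a n : (forall c d, B c d = 0%R \/ B c d = 1%R) ->
  first_return_count B n.+1 a = first_passage a n a.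
Proof.
move=> B01.
pose paths m c := [set p | [/\ path (fun c d => B c d != 0%R) c p, size p = m.+1,
  last c p = a & a \notin behead (belast c p)]].
rewrite /first_return_count -/(paths n a).
suff -> c : \esum_(p in paths n c) 1 = first_passage a n c by [].
elim: n c => [|n IH] c.
  rewrite /=; have [Bca|Bca] := B01 c a.
    rewrite Bca esum1// => p [/=]; case: p => [|d [|]]//= /andP[+ _] _ da.
    by rewrite da Bca eqxx.
  rewrite Bca (_ : paths 0%N c = [set [:: a]]) ?esum_set1//.
  apply/seteqP; split => [p [] |p -> /=].
    by case: p => [|d [|]]//= _ _ ->.
  by split => //=; rewrite Bca oner_eq0.
pose D := [set d | d != a /\ B c d != 0%R].
transitivity (\esum_(d in D) \esum_(p in paths n d) (1 : \bar R)).
  rewrite esum_esum//.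
  rewrite (@reindex_esum R _ _ (D `*`` paths n) (paths n.+1 c) (fun k => k.1 :: k.2) (fun=> 1))//.
  split => /=.
  - move=> [d p] /= [[da cd] [pp sp lp ap]]; split => //=.
    + by rewrite cd.
    + by rewrite sp.
    + by case: p sp ap {pp lp} => //= e p _; rewrite inE negb_or eq_sym da => ->.
  - by move=> [d p] [e r] _ _ /= [-> ->].
  - move=> [|d p] [] //= /andP[cd pp] [sp] lp ap; exists (d, p) => //=.
    case: p sp pp lp ap => // e p sp pp lp /=; rewrite inE negb_or => /andP[ad ap].
    by split => //; split => //; rewrite eq_sym.
rewrite esum_mkcond /=; apply: eq_esum => d _.
case: ifPn => [|].
  rewrite inE => -[/negPf -> cd]; rewrite IH.
  by have [cd0|->] := B01 c d; [rewrite cd0 eqxx in cd | rewrite mul1e].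
rewrite notin_setE /D /= => nD; case: ifPn => // da.
by have [->|cd] := B01 c d; rewrite ?mul0e//; case: nD; rewrite da cd oner_eq0.
Qed.

End FirstPassage.

(** * Return probabilities *)

Section Recurrence.
Context {R : realType} {I : countType}.
Variables (B : I -> I -> R) (lambda : R).
Hypotheses (B_ge0 : forall a b, 0 <= B a b) (lambda_gt0 : 0 < lambda).
Local Open Scope ereal_scope.

Let lamV_ge0 n : (0 <= (lambda ^- n)%:E :> \bar R).
Proof. by rewrite lee_fin invr_ge0 exprn_ge0// ltW. Qed.

Let EB_ge0 a b : 0 <= (B a b)%:E.
Proof. by rewrite lee_fin. Qed.

Let lamVS n : (lambda ^- n)%:E = lambda%:E * (lambda ^- n.+1)%:E.
Proof.
by rewrite -EFinM exprS invfM mulrA divff ?gt_eqF// mul1r.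
Qed.

(** The probability of a first return at time n.+1 for the chain with transition
    weights B a b * H b / (lambda * H a): the factors H cancel along a closed
    path, whatever H is. *)
Definition return_prob (a : I) (n : nat) : \bar R :=
  first_passage B a n a * (lambda ^- n.+1)%:E.

Lemma return_prob_ge0 a n : 0 <= return_prob a n.
Proof. by rewrite mule_ge0// first_passage_ge0. Qed.

Lemma renewal a n : mxpow B n.+1 a a * (lambda ^- n.+1)%:E =
  \sum_(k < n.+1) return_prob a k * (mxpow B (n - k) a a * (lambda ^- (n - k))%:E).
Proof.
rewrite mxpow_first_passage// ge0_sume_distrl.
  apply: eq_bigr => k _; rewrite /return_prob.
  rewrite [in RHS]muleACA -[in RHS]EFinM -invfM -exprD addSn subnKC//.
  by rewrite -ltnS.
by move=> k _; rewrite mule_ge0 ?first_passage_ge0 ?mxpow_ge0.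
Qed.

(** If these probabilities had a sum r < 1, the renewal equation would bound the
    partial sums of the return series by (1 - r)^-1. *)
Lemma recurrent_return_prob a : return_series lambda B a = +oo ->
  1 <= \esum_(n in [set: nat]) return_prob a n.
Proof.
move=> rec; rewrite leNgt; apply/negP => F1.
set F := \esum_(n in _) _ in F1.
have F0 : 0 <= F by apply: esum_ge0 => n _; exact: return_prob_ge0.
have Ffin : F \is a fin_num by rewrite ge0_fin_numE// (lt_trans F1)// ltry.
pose r := fine F; have Fr : F = r%:E by rewrite fineK.
have r1 : (r < 1)%R by rewrite -lte_fin -Fr.
have r0 : (0 <= r)%R by rewrite -lee_fin -Fr.
pose y n := mxpow B n a a * (lambda ^- n)%:E.
have y0 n : 0 <= y n by rewrite mule_ge0 ?mxpow_ge0.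
pose c := ((1 - r)^-1)%R.
have c0 : (0 <= c)%R by rewrite invr_ge0 subr_ge0 ltW.
have rc : (1 + r * c = c)%R.
  rewrite /c; apply: (@mulIf _ (1 - r)%R); first by rewrite subr_eq0 gt_eqF.
  by rewrite mulrDl -mulrA mulVf ?subr_eq0 ?gt_eqF// mulr1 mul1r subrK.
have S_le N : \sum_(0 <= n < N) y n <= c%:E.
  elim: N => [|N IH]; first by rewrite big_nil.
  rewrite big_mkord big_ord_recl /= {1}/y /= eqxx mul1e expr0 invr1.
  have -> : \sum_(i < N) y (bump 0 i) =
      \sum_(n < N) \sum_(k < N | (k < n.+1)%N) return_prob a k * y (n - k)%N.
    apply: eq_bigr => n _; rewrite /bump add1n /y renewal.
    exact: (big_ord_widen N (fun k => return_prob a k * y (n - k)%N)).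
  rewrite (exchange_big_dep xpredT)//= -rc EFinD; apply: leeD => //.
  apply: (@le_trans _ _ (\sum_(k < N) return_prob a k * c%:E)).
    apply: lee_sum => k _; rewrite -ge0_sume_distrr//.
    apply: lee_wpmul2l; first exact: return_prob_ge0.
    apply: le_trans IH.
    rewrite (eq_bigl (fun n : 'I_N => xpredT (n : nat) && (k <= n)%N))//.
    rewrite -(big_geq_mkord k N xpredT (fun n => y (n - k)%N)).
    rewrite -{1}[k : nat]add0n big_addn.
    under eq_bigr do rewrite addnK.
    by rewrite [leRHS](@big_cat_nat _ _ _ (N - k))//= ?leq_subr// leeDl// sume_ge0.
  rewrite -ge0_sume_distrl; last by move=> k _; exact: return_prob_ge0.
  rewrite EFinM -Fr; apply: lee_wpmul2r => //.
  rewrite /F -nneseries_esumT; last exact: return_prob_ge0.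
  rewrite -(big_mkord xpredT (return_prob a)).
  by apply: nneseries_lim_ge => n _ _; exact: return_prob_ge0.
have : return_series lambda B a <= c%:E.
  apply: lime_le; first by apply: is_cvg_nneseries => n _ _; exact: y0.
  by apply: nearW => n; exact: S_le.
by rewrite rec leye_eq.
Qed.

Variable H : I -> R.
Hypotheses (H_gt0 : forall a, (0 < H a)%R)
  (H_sub : forall a, \esum_(b in [set: I]) ((B a b)%:E * (H b)%:E) <= (lambda * H a)%:E).

Let EH_ge0 a : 0 <= (H a)%:E.
Proof. by rewrite lee_fin ltW. Qed.

(** H a times the probability that the chain, started at a, is still alive and
    has not come back at time n.  The chain may lose mass, since H is only
    subinvariant. *)
Definition survival (a : I) (n : nat) : \bar R :=
  (\esum_(b in [set: I]) (taboo B a n b * (H b)%:E)) * (lambda ^- n)%:E.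

Lemma survival_ge0 a n : 0 <= survival a n.
Proof.
by rewrite mule_ge0//; apply: esum_ge0 => b _; rewrite mule_ge0 ?taboo_ge0.
Qed.

Lemma survival0 a : survival a 0 = (H a)%:E.
Proof.
by rewrite /survival expr0 invr1 mule1 /= (@esum_delta _ _ a (fun b => (H b)%:E)).
Qed.

(** In one step the surviving mass returns to a, survives or is lost; the
    subinvariance of H says that none is created. *)
Lemma survivalS a n :
  survival a n.+1 + return_prob a n * (H a)%:E <= survival a n.
Proof.
have t0 c : 0 <= taboo B a n c by exact: taboo_ge0.
have tBH0 b c : 0 <= taboo B a n c * (B c b)%:E by rewrite mule_ge0.
rewrite /survival /return_prob.
have -> : first_passage B a n a = \esum_(c in [set: I]) (taboo B a n c * (B c a)%:E).
  by rewrite -[in LHS](addn0 n) -taboo_first_passage.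
rewrite [X in _ + X]muleAC -ge0_muleDl; first last.
- by rewrite mule_ge0//; apply: esum_ge0 => c _.
- by apply: esum_ge0 => c _; rewrite mule_ge0// taboo_ge0.
have -> : \esum_(b in [set: I]) (taboo B a n.+1 b * (H b)%:E) +
     (\esum_(c in [set: I]) (taboo B a n c * (B c a)%:E)) * (H a)%:E =
   \esum_(b in [set: I]) ((\esum_(c in [set: I]) (taboo B a n c * (B c b)%:E)) * (H b)%:E).
  rewrite [RHS](esumID [set a])//; last first.
    by move=> b _; rewrite mule_ge0//; exact: esum_ge0.
  rewrite [in RHS]setTI esum_set1; last by rewrite mule_ge0//; exact: esum_ge0.
  rewrite addeC setTI; congr (_ + _); rewrite [RHS]esum_mkcond.
  apply: eq_esum => b _ /=; case: eqVneq => [->|ba].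
    by rewrite mul0e ifF//; apply/negP; rewrite inE => /(_ erefl).
  by rewrite ifT// inE => /= /eqP; exact/negP.
rewrite [leRHS]muleC (lamVS n) [lambda%:E * _]muleC -muleA.
rewrite [leLHS]muleC; apply: lee_wpmul2l => //.
rewrite -esumZl; [|by rewrite lee_fin ltW|by move=> b _; rewrite mule_ge0].
under eq_esum => b _ do rewrite -esumZr//.
rewrite esum_exchange; last by move=> b c; rewrite !mule_ge0.
apply: le_esum => c _; rewrite (eq_esum (b := fun b => taboo B a n c * ((B c b)%:E * (H b)%:E))).
  rewrite esumZl//; last by move=> b _; rewrite mule_ge0.
  by rewrite muleCA -EFinM; apply: lee_wpmul2l.
by move=> b _; rewrite muleA.
Qed.

Lemma survival_le a n :
  survival a n + (\sum_(0 <= k < n) return_prob a k) * (H a)%:E <= (H a)%:E.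
Proof.
elim: n => [|n IH]; first by rewrite big_nil mul0e adde0 survival0.
apply: le_trans IH; rewrite big_nat_recr//= ge0_muleDl ?return_prob_ge0//; last first.
  by apply: sume_ge0 => k _; exact: return_prob_ge0.
by rewrite addeCA [leRHS]addeC; apply: leeD => //; exact: survivalS.
Qed.

Lemma return_prob_le1 a : \esum_(n in [set: nat]) return_prob a n <= 1.
Proof.
rewrite -nneseries_esumT; last exact: return_prob_ge0.
apply: lime_le; first by apply: is_cvg_nneseries => n _ _; exact: return_prob_ge0.
apply: nearW => n; rewrite -(@lee_pmul2r _ (H a)%:E)// ?lte_fin// mul1e.
by apply: le_trans (survival_le a n); rewrite leeDr// survival_ge0.
Qed.

Hypothesis B01 : forall a b, B a b = 0%R \/ B a b = 1%R.

(** Recurrence makes the return probabilities add up to 1, so that nothing is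
    lost and what survives time n must return later. *)
Lemma survival_tail a n : return_series lambda B a = +oo ->
  survival a n <= (\esum_(k in [set: nat]) return_prob a (n + k)) * (H a)%:E.
Proof.
move=> rec; have f0 := return_prob_ge0 a.
have F1 : \esum_(n in [set: nat]) return_prob a n = 1.
  by apply/eqP; rewrite eq_le return_prob_le1 recurrent_return_prob.
have split : \sum_(0 <= k < n) return_prob a k +
    \esum_(k in [set: nat]) return_prob a (n + k) = 1.
  rewrite -F1; elim: n => [|n IH]; first by rewrite big_nil add0e.
  rewrite -IH big_nat_recr//= -addeA; congr (_ + _).
  rewrite [RHS]esum_nat_recl// addn0; congr (_ + _).
  by apply: eq_esum => k _; rewrite addSnnS.
have Sfin : \sum_(0 <= k < n) return_prob a k \is a fin_num.
  rewrite ge0_fin_numE; last by rewrite sume_ge0.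
  by rewrite (@le_lt_trans _ _ 1) ?ltry// -split leeDl// esum_ge0.
have := survival_le a n.
rewrite -{2}[(H a)%:E]mul1e -split ge0_muleDl ?esum_ge0// ?sume_ge0//.
by rewrite addeC leeD2lE// fin_numM.
Qed.

(** The mean of the return time is the sum of its tails. *)
Lemma mean_returnE a : mean_return_series lambda B a =
  \esum_(n in [set: nat]) \esum_(k in [set: nat]) return_prob a (n + k).
Proof.
have f0 := return_prob_ge0 a.
pose g n := n%:R%:E * first_return_count B n a * (lambda ^- n)%:E.
have g0 n : 0 <= g n.
  apply: mule_ge0 => //; apply: mule_ge0; first by rewrite lee_fin.
  by apply: esum_ge0.
have -> : mean_return_series lambda B a = \esum_(n in [set: nat]) g n.+1.
  have : \esum_(n in [set: nat]) g n = \esum_(n in [set: nat]) g n.+1.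
    by rewrite esum_nat_recl// {1}/g mul0e mul0e add0e.
  rewrite -nneseries_esumT// nneseries_recl// {1}/g mul0e mul0e add0e => <-.
  by [].
transitivity (\esum_(n in [set: nat]) \esum_(m in [set: nat])
    if (m <= n)%N then return_prob a n else 0).
  apply: eq_esum => n _; rewrite /g first_return_countE// -muleA -/(return_prob a n).
  rewrite -nneseries_esumT; last by move=> m; case: ifP.
  rewrite (@nneseries_split _ _ 0 n.+1); last by move=> m _; case: ifP.
  rewrite add0n [X in _ = _ + X]eseries0 ?adde0; last first.
    by move=> m nm _; rewrite leqNgt nm.
  rewrite big_mkord (eq_bigr (fun=> return_prob a n)); last first.
    by move=> m _; rewrite -ltnS ltn_ord.
  by rewrite big_const_ord iter_addr_0 mule_natl.
rewrite esum_exchange; last by move=> n m; case: ifP.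
apply: eq_esum => m _.
rewrite (eq_esum (b := fun n => if n \in [set n | (m <= n)%N]
    then return_prob a n else 0)); last first.
  move=> n _; case: ifPn => [mn|nmn]; first by rewrite mem_set.
  by rewrite memNset//; exact/negP.
rewrite -esum_mkcond.
apply: (@reindex_esum R _ _ [set: nat] _ (addn m) (return_prob a)); split => /=.
- by move=> n _ /=; exact: leq_addr.
- by move=> n p _ _ /addnI.
- by move=> n /= mn; exists (n - m)%N; rewrite ?subnKC.
Qed.

End Recurrence.

(** * The occupation measure of an excursion *)

Section Stationary.
Context {R : realType} {I : countType}.
Variables (B : I -> I -> R) (lambda : R).
Hypotheses (B_ge0 : forall a b, 0 <= B a b) (lambda_gt0 : 0 < lambda).
Local Open Scope ereal_scope.

Let lamV_ge0 n : (0 <= (lambda ^- n)%:E :> \bar R).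
Proof. by rewrite lee_fin invr_ge0 exprn_ge0// ltW. Qed.

Let EB_ge0 a b : 0 <= (B a b)%:E.
Proof. by rewrite lee_fin. Qed.

Let lam_ge0 : 0 <= lambda%:E.
Proof. by rewrite lee_fin ltW. Qed.

Definition invariant (p : I -> \bar R) :=
  (forall b, 0 <= p b) /\
  (forall b, \esum_(c in [set: I]) (p c * (B c b)%:E) = lambda%:E * p b).

Lemma invariantX (p : I -> \bar R) n b : invariant p ->
  \esum_(c in [set: I]) (p c * mxpow B n c b) = (lambda ^+ n)%:E * p b.
Proof.
move=> [p0 pB]; elim: n => [|n IH].
  rewrite expr0 mul1e -[RHS](@esum_delta _ _ b p)//.
  by apply: eq_esum => c _; rewrite muleC.
transitivity (\esum_(c in [set: I]) \esum_(d in [set: I])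
    ((p c * (B c d)%:E) * mxpow B n d b)).
  apply: eq_esum => c _; rewrite /= -esumZl//.
    by apply: eq_esum => d _; rewrite muleA.
  by move=> d _; rewrite mule_ge0 ?mxpow_ge0.
rewrite esum_exchange; last by move=> c d; rewrite !mule_ge0 ?mxpow_ge0.
transitivity (\esum_(d in [set: I]) (lambda%:E * (p d * mxpow B n d b))).
  apply: eq_esum => d _; rewrite esumZr ?mxpow_ge0//.
    by rewrite pB muleA.
  by move=> c _; rewrite mule_ge0.
rewrite esumZl//; last by move=> d _; rewrite mule_ge0 ?mxpow_ge0.
by rewrite IH muleA -EFinM -exprS.
Qed.

Variable H : I -> R.
Hypotheses (H_gt0 : forall a, (0 < H a)%R)
  (H_sub : forall a, \esum_(b in [set: I]) ((B a b)%:E * (H b)%:E) <= (lambda * H a)%:E)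
  (B01 : forall a b, B a b = 0%R \/ B a b = 1%R).

Let EH_ge0 a : 0 <= (H a)%:E.
Proof. by rewrite lee_fin ltW. Qed.

(** H a / H b times the expected number of visits to b before the first return
    to a. *)
Definition occupation (a b : I) : \bar R :=
  \esum_(n in [set: nat]) (taboo B a n b * (lambda ^- n)%:E).

Lemma occupation_ge0 a b : 0 <= occupation a b.
Proof. by apply: esum_ge0 => n _; rewrite mule_ge0// taboo_ge0. Qed.

Lemma occupation_start a : occupation a a = 1.
Proof.
rewrite /occupation esum_nat_recl; last by move=> n; rewrite mule_ge0// taboo_ge0.
rewrite esum1; last by move=> n _; rewrite /= eqxx mul0e.
by rewrite adde0 /= eqxx mul1e expr0 invr1.
Qed.

(** The visits before the first return, over all b, add up to the return time. *)
Lemma occupation_summable a : return_series lambda B a = +oo ->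
  mean_return_series lambda B a < +oo ->
  \esum_(b in [set: I]) (occupation a b * (H b)%:E) < +oo.
Proof.
move=> rec mean.
have t0 n b : 0 <= taboo B a n b by exact: taboo_ge0.
have -> : \esum_(b in [set: I]) (occupation a b * (H b)%:E) =
    \esum_(n in [set: nat]) survival B lambda H a n.
  transitivity (\esum_(b in [set: I]) \esum_(n in [set: nat])
      (taboo B a n b * (H b)%:E * (lambda ^- n)%:E)).
    apply: eq_esum => b _; rewrite -esumZr//; last by move=> n _; rewrite mule_ge0.
    by apply: eq_esum => n _; rewrite muleAC.
  rewrite esum_exchange; last by move=> b n; rewrite !mule_ge0.
  by apply: eq_esum => n _; rewrite esumZr// => b _; rewrite mule_ge0.
apply: le_lt_trans (_ : mean_return_series lambda B a * (H a)%:E < +oo).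
  rewrite mean_returnE// -esumZr//.
    by apply: le_esum => n _; exact: survival_tail.
  by move=> n _; apply: esum_ge0 => k _; exact: return_prob_ge0.
have mean0 : 0 <= mean_return_series lambda B a.
  rewrite mean_returnE//; apply: esum_ge0 => n _; apply: esum_ge0 => k _.
  exact: return_prob_ge0.
by rewrite lte_mul_pinfty ?ltry// ge0_fin_numE.
Qed.

(** One more step moves each excursion from a forward by one; what arrives at a
    is the total return probability, which is 1. *)
Lemma occupation_invariant a : return_series lambda B a = +oo ->
  invariant (occupation a).
Proof.
move=> rec; split=> [|b]; first exact: occupation_ge0.
have t0 n c : 0 <= taboo B a n c by exact: taboo_ge0.
have -> : \esum_(c in [set: I]) (occupation a c * (B c b)%:E) =
    \esum_(n in [set: nat])
      ((\esum_(c in [set: I]) (taboo B a n c * (B c b)%:E)) * (lambda ^- n)%:E).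
  transitivity (\esum_(c in [set: I]) \esum_(n in [set: nat])
      (taboo B a n c * (B c b)%:E * (lambda ^- n)%:E)).
    apply: eq_esum => c _; rewrite -esumZr//; last by move=> n _; rewrite mule_ge0.
    by apply: eq_esum => n _; rewrite muleAC.
  rewrite esum_exchange; last by move=> c n; rewrite !mule_ge0.
  by apply: eq_esum => n _; rewrite esumZr// => c _; rewrite mule_ge0.
have lamVS n : (lambda ^- n)%:E = lambda%:E * (lambda ^- n.+1)%:E.
  by rewrite -EFinM exprS invfM mulrA divff ?gt_eqF// mul1r.
have [->|ba] := eqVneq b a.
  rewrite occupation_start mule1.
  transitivity (\esum_(n in [set: nat]) (lambda%:E * return_prob B lambda a n)).
    apply: eq_esum => n _; rewrite /return_prob lamVS muleCA.
    by have := taboo_first_passage B_ge0 a n 0; rewrite addn0 => <-.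
  rewrite esumZl//; last by move=> n _; exact: return_prob_ge0.
  suff -> : \esum_(n in [set: nat]) return_prob B lambda a n = 1 by rewrite mule1.
  by apply/eqP; rewrite eq_le (return_prob_le1 B_ge0 lambda_gt0 H_gt0 H_sub) recurrent_return_prob.
rewrite /occupation [in RHS]esum_nat_recl /= ?(negPf ba); last first.
  by move=> n; rewrite mule_ge0.
rewrite mul0e add0e -esumZl//; last first.
  by move=> n _; rewrite mule_ge0// esum_ge0// => c _; rewrite mule_ge0.
by apply: eq_esum => n _; rewrite lamVS muleCA.
Qed.

End Stationary.

Section SumAux.
Context {R : realType}.
Local Open Scope ereal_scope.

Lemma esum_inj_le (T U : choiceType) (e : T -> U) (a : U -> \bar R) :
  injective e -> (forall u, 0 <= a u) ->
  \esum_(t in [set: T]) a (e t) <= \esum_(u in [set: U]) a u.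
Proof.
move=> inj_e a0; rewrite -(@esum_image R _ _ [set: T] e a); last first.
  by move=> x y _ _; exact: inj_e.
by rewrite esum_mkcond; apply: le_esum => u _; case: ifP.
Qed.

Lemma esum_le_eq (T : choiceType) (a b : T -> \bar R) t :
  (forall i, 0 <= a i <= b i) ->
  \esum_(i in [set: T]) b i = \esum_(i in [set: T]) a i ->
  \esum_(i in [set: T]) a i < +oo -> a t = b t.
Proof.
move=> ab; have a0 i : 0 <= a i by case/andP: (ab i).
have ba i : a i <= b i by case/andP: (ab i).
have b0 i : 0 <= b i by exact: le_trans (ba i).
rewrite (esumID [set t] _ b)// (esumID [set t] _ a)// !setTI.
rewrite !esum_set1// => eqs fin.
have [//|ne] := eqVneq (a t) (b t).
have lt_ab : a t < b t by rewrite lt_neqAle ne ba.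
have : a t + \esum_(i in ~` [set t]) a i < b t + \esum_(i in ~` [set t]) b i.
  rewrite lte_leD//; last by apply: le_esum.
  rewrite ge0_fin_numE ?esum_ge0//; apply: le_lt_trans fin.
  by rewrite leeDr.
by rewrite eqs ltxx.
Qed.

Lemma finite_set_argmax (T : choiceType) (X : set T) (g : T -> R) x :
  finite_set X -> X x -> exists2 y, X y & forall z, X z -> (g z <= g y)%R.
Proof.
move=> /finite_seqP[s ->] /=.
elim: s x => [//|u s IH] x; rewrite inE => xus.
case: s IH xus => [|v s] IH xus.
  by exists u => [|z] /=; rewrite !inE ?eqxx// => /eqP ->.
have [y ys ymax] := IH v (mem_head _ _).
have [guy|gyu] := leP (g u) (g y).
  exists y => [|z] /=; first by rewrite inE ys orbT.
  by rewrite inE => /predU1P[->//|]; exact: ymax.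
exists u => [|z] /=; first by rewrite inE eqxx.
by rewrite inE => /predU1P[->//|/ymax/le_trans]; apply; exact: ltW.
Qed.

End SumAux.

(** * Shift-invariant matrices *)

Section Shift.
Context {R : realType} {T : finType}.
Local Notation I := (T * int)%type.
Variables (B : I -> I -> R) (H : I -> R) (lambda : R) (s : int).

Definition shift (k : int) (b : I) : I := (b.1, b.2 + k).

Lemma shift_shift k l b : shift k (shift l b) = shift (k + l) b.
Proof. by rewrite /shift /= -addrA [l + k]addrC. Qed.

Lemma shift0 b : shift 0 b = b.
Proof. by case: b => i j; rewrite /shift /= addr0. Qed.

Lemma shift_inj k : injective (shift k).
Proof. by move=> [i j] [i' j'] [/= -> /addIr ->]. Qed.

Hypotheses (B01 : forall a b, B a b = 0%R \/ B a b = 1%R) (lambda_gt0 : 0 < lambda).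
Hypotheses (H_gt0 : forall a, 0 < H a) (H_shift : forall k a, H (shift k a) = H a).
Hypothesis (H_sub : forall a,
  (\esum_(b in [set: I]) ((B a b)%:E * (H b)%:E) <= (lambda * H a)%:E)%E).
Hypotheses (s_sign : s * s = 1)
  (B_shift : forall k c b, B (shift k c) (shift (s * k) b) = B c b).
Hypothesis (B_irr : irreducible_mx B).
Local Open Scope ereal_scope.

Let B_ge0 a b : (0 <= B a b)%R.
Proof. by case: (B01 a b) => ->. Qed.

Lemma reindex_shift k (F : I -> \bar R) :
  \esum_(c in [set: I]) F (shift k c) = \esum_(c in [set: I]) F c.
Proof.
rewrite (@reindex_esum R _ _ [set: I] [set: I] (shift k) F)//; split => //=.
  by move=> b c _ _; exact: shift_inj.
by move=> b _; exists (shift (- k) b) => //; rewrite shift_shift subrr shift0.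
Qed.

(** The sum nu of the translates of p is invariant, as [B_shift] turns the
    translate by k into the translate by s * k and this permutes the integers.
    Since p has a finite total weight, p / nu tends to 0 along each copy of the
    integers, hence has a maximum c.  Then c * nu - p is a nonnegative
    eigenvector that vanishes at some index, so everywhere by irreducibility.
    So p is invariant under translations and its total weight is infinite. *)
Lemma no_finite_invariant (p : I -> \bar R) a : invariant B lambda p -> 0 < p a ->
  \esum_(b in [set: I]) (p b * (H b)%:E) < +oo -> False.
Proof.
move=> [p0 pB] pa pfin; have pinv : invariant B lambda p by [].
have EH0 b : 0 <= (H b)%:E by rewrite lee_fin ltW.
have p_gt0 b : 0 < p b.
  have [N _ abN] := B_irr a b.
  have : 0 < (lambda ^+ N)%:E * p b.
    rewrite -(invariantX B_ge0 lambda_gt0 _ _ pinv).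
    apply: (@lt_le_trans _ _ (p a * mxpow B N a b)); first exact: mule_gt0.
    apply: (@esum_ge_term _ _ _ (fun c => p c * mxpow B N c b)) => // c _.
    by rewrite mule_ge0// mxpow_ge0.
  by rewrite pmule_rgt0// lte_fin exprn_gt0.
pose nu b := \esum_(k in [set: int]) p (shift k b).
have nu_shift l b : nu (shift l b) = nu b.
  rewrite /nu (@reindex_esum R int int setT setT (fun k => (k + l)%R) (fun k => p (shift k b)))//.
    by apply: eq_esum => k _; rewrite shift_shift.
  split => //= [k k' _ _ /addIr//|k _]; exists (k - l)%R => //; exact: subrK.
have p_le_nu b : p b <= nu b.
  rewrite -{1}(shift0 b).
  exact: (@esum_ge_term _ _ _ (fun k => p (shift k b))).
have nu_fin b : nu b < +oo.
  have : nu b * (H b)%:E < +oo.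
    apply: le_lt_trans pfin; rewrite -esumZr//.
    rewrite (eq_esum (b := fun k => p (shift k b) * (H (shift k b))%:E)).
      apply: (@esum_inj_le _ _ _ (shift^~ b) (fun c => p c * (H c)%:E)).
        by move=> k l [] /addrI.
      by move=> c; rewrite mule_ge0.
    by move=> k _; rewrite H_shift.
  rewrite !ltey; apply: contra => /eqP ->.
  by rewrite gt0_mulye ?lte_fin.
have nu_gt0 b : 0 < nu b by apply: lt_le_trans (p_le_nu b).
have nu_inv : invariant B lambda nu.
  split=> [b|b]; first exact: ltW.
  transitivity (\esum_(c in [set: I]) \esum_(k in [set: int])
      (p (shift k c) * (B c b)%:E)).
    by apply: eq_esum => c _; rewrite esumZr// lee_fin.
  rewrite esum_exchange; last by move=> c k; rewrite mule_ge0// lee_fin.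
  transitivity (\esum_(k in [set: int]) (lambda%:E * p (shift (s * k) b))).
    apply: eq_esum => k _; rewrite -pB -[RHS](reindex_shift k); apply: eq_esum => c _.
    by rewrite B_shift.
  rewrite esumZl//; last by rewrite lee_fin ltW.
  congr (_ * _).
  rewrite /nu (@reindex_esum R int int setT setT (fun k => (s * k)%R) (fun k => p (shift k b)))//.
  split => //= [k k' _ _ /(congr1 (fun x => (s * x)%R))|k _].
    by rewrite !mulrA s_sign !mul1r.
  by exists (s * k)%R => //; rewrite mulrA s_sign mul1r.
have pnum b : p b \is a fin_num.
  by rewrite ge0_fin_numE// (le_lt_trans (p_le_nu b)).
have nnum b : nu b \is a fin_num by rewrite ge0_fin_numE// ltW.
pose g b := (fine (p b) / fine (nu b))%R.
have fnu b : (0 < fine (nu b))%R by rewrite fine_gt0// nu_gt0 nu_fin.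
have ga : (0 < g a)%R by rewrite divr_gt0// fine_gt0// pa ltey_eq pnum.
(* Few indices have a ratio at least g a: where the first component is fixed,
   nu and H are constant and p takes large values finitely often. *)
have [a0 _ a0max] : exists2 a0, [set b | g a <= g b]%R a0 &
    forall b, [set b | g a <= g b]%R b -> (g b <= g a0)%R.
  apply: (@finite_set_argmax _ _ _ _ a) => /=; last by [].
  apply: (@sub_finite_set _ _ (\bigcup_(i in [set: T])
      [set b | (g a * fine (nu (i, Posz 0)) * H (i, Posz 0))%:E <= p b * (H b)%:E])).
    move=> [i j] /= gab; exists i => //=.
    have e : (i, j) = shift j (i, Posz 0) by rewrite /shift /= add0r.
    rewrite {2}e H_shift -(fineK (pnum _)) -EFinM lee_fin ler_wpM2r ?(ltW (H_gt0 _))//.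
    by rewrite -(nu_shift j) -e -ler_pdivlMr.
  apply: bigcup_finite => [|i _]; first exact: finite_finset.
  apply: finite_esum_ge => //; first by move=> b; rewrite mule_ge0.
  by apply: mulr_gt0 => //; apply: mulr_gt0.
pose c := g a0.
have c0 : (0 < c)%R by apply: lt_le_trans ga (a0max a (lexx _)).
have p_le b : p b <= c%:E * nu b.
  rewrite -(fineK (pnum _)) -(fineK (nnum _)) -EFinM lee_fin -ler_pdivrMr//.
  by have [/a0max//|/ltW/le_trans] := leP (g a) (g b); apply; exact: (a0max a (lexx _)).
have p_a0 : p a0 = c%:E * nu a0.
  by rewrite -(fineK (pnum _)) -(fineK (nnum _)) -EFinM divfK// gt_eqF.
have p_eq b : p b = c%:E * nu b.
  apply/eqP; rewrite eq_le p_le /= leNgt; apply/negP => lt_b.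
  have [N _ bN] := B_irr b a0.
  have Mp := invariantX B_ge0 lambda_gt0 N a0 pinv; have Mn := invariantX B_ge0 lambda_gt0 N a0 nu_inv.
  have M0 d : 0 <= mxpow B N d a0 by exact: mxpow_ge0.
  have pfinN : (lambda ^+ N)%:E * p a0 < +oo.
    by rewrite -(fineK (pnum _)) -EFinM ltry.
  have Mb : mxpow B N b a0 \is a fin_num.
    rewrite ge0_fin_numE//; have : p b * mxpow B N b a0 < +oo.
      apply: le_lt_trans pfinN; rewrite -Mp.
      apply: (@esum_ge_term _ _ _ (fun c => p c * mxpow B N c a0)) => // d _.
      by rewrite mule_ge0.
    by rewrite !ltey; apply: contra => /eqP ->; rewrite gt0_muley.
  have := @esum_le_eq R _ (fun d => p d * mxpow B N d a0)
    (fun d => c%:E * nu d * mxpow B N d a0) b.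
  have -> : \esum_(i in [set: I]) (c%:E * nu i * mxpow B N i a0) =
      \esum_(i in [set: I]) (p i * mxpow B N i a0).
    rewrite Mp p_a0 muleCA -Mn -esumZl ?lee_fin ?(ltW c0)//.
      by apply: eq_esum => d _; rewrite muleA.
    by move=> d _; rewrite mule_ge0// ltW.
  rewrite Mp => /(_ _ erefl pfinN) eqb.
  have : p b * mxpow B N b a0 < c%:E * nu b * mxpow B N b a0.
    by rewrite lte_pmul2r.
  rewrite eqb ?ltxx// => d; rewrite mule_ge0//=.
  exact: lee_wpmul2r.
have : \esum_(n in [set: nat]) p (shift (Posz n) a) < +oo.
  apply: le_lt_trans (nu_fin a).
  apply: (@esum_inj_le _ _ _ Posz (fun k => p (shift k a))) => //.
  by move=> m n [].
have -> : (fun n : nat => p (shift (Posz n) a)) = (fun _ => p a).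
  by apply/funext => n; rewrite p_eq nu_shift -p_eq.
move=> /(finite_esum_ge (fun _ => ltW pa)) => /(_ (fine (p a))).
rewrite fine_gt0 ?pa ?ltey_eq ?pnum// => /(_ isT).
rewrite fineK// => fin; apply: infinite_nat.
by apply: sub_finite_set fin => n _ /=; rewrite lexx.
Qed.

(** By irreducibility, recurrence at one index spreads to all; a finite mean
    return time would then make the occupation measure a finite invariant one. *)
Theorem shift_invariant_transient_or_null :
  transient lambda B \/ null_recurrent lambda B.
Proof.
have lamV_ge0 n : (0 <= (lambda ^- n)%:E :> \bar R).
  by rewrite lee_fin invr_ge0 exprn_ge0// ltW.
have [tr|/existsNP[a /negP]] := pselect (transient lambda B); first by left.
rewrite -leNgt leye_eq => /eqP rec_a; right.
have rec : recurrent lambda B.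
  move=> b; have [M _ Mba] := B_irr b a; have [N _ Nab] := B_irr a b.
  apply/eqP; rewrite -leye_eq.
  pose x := mxpow B M b a * (lambda ^- M)%:E.
  pose y := mxpow B N a b * (lambda ^- N)%:E.
  have x0 : 0 < x by rewrite mule_gt0// lte_fin invr_gt0 exprn_gt0.
  have y0 : 0 < y by rewrite mule_gt0// lte_fin invr_gt0 exprn_gt0.
  have w0 n c : 0 <= mxpow B n c c * (lambda ^- n)%:E by rewrite mule_ge0 ?mxpow_ge0.
  have <- : x * return_series lambda B a * y = +oo.
    by rewrite rec_a gt0_muley// gt0_mulye.
  rewrite /return_series !nneseries_esumT// -esumZl//; last exact: ltW.
  rewrite -esumZr//; [|exact: ltW|by move=> n _; rewrite mule_ge0// ltW].
  apply: le_trans (_ : _ <= \esum_(n in [set: nat])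
      (mxpow B (M + (n + N)) b b * (lambda ^- (M + (n + N)))%:E)) _; last first.
    apply: (@esum_inj_le _ _ _ (fun n => M + (n + N))%N
       (fun n => mxpow B n b b * (lambda ^- n)%:E)) => // m n /addnI.
    by move=> /addIn.
  apply: le_esum => n _; rewrite exprD invfM exprD invfM !EFinM.
  have -> : x * (mxpow B n a a * (lambda ^- n)%:E) * y =
     mxpow B M b a * (mxpow B n a a * mxpow B N a b) *
     ((lambda ^- M)%:E * ((lambda ^- n)%:E * (lambda ^- N)%:E)).
    by rewrite /x /y [X in X * _ = _]muleACA [LHS]muleACA !muleA.
  apply: lee_wpmul2r; first by rewrite !mule_ge0.
  rewrite mxpowD//.
  apply: le_trans (_ : _ <= mxpow B M b a * mxpow B (n + N) a b) _.
    apply: lee_wpmul2l; first exact: mxpow_ge0.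
    rewrite mxpowD//; apply: (@esum_ge_term _ _ _ (fun c => mxpow B n a c * mxpow B N c b)) => // c _.
    by rewrite mule_ge0 ?mxpow_ge0.
  apply: (@esum_ge_term _ _ _ (fun c => mxpow B M b c * mxpow B (n + N) c b)) => // c _.
  by rewrite mule_ge0 ?mxpow_ge0.
split=> // b.
have := @occupation_invariant _ _ _ _ B_ge0 lambda_gt0 _ H_gt0 H_sub b (rec b).
apply: contraPP => /eqP mean_b inv.
apply: (no_finite_invariant inv (_ : 0 < occupation B lambda b b)).
  by rewrite occupation_start.
by apply: occupation_summable; rewrite ?ltey.
Qed.

End Shift.

(** * The lift and the deck group *)

Section Zpow.
Context {X : topologicalType}.
Variable h : homeo X X.

Lemma zpowS j x : zpow h (j + 1) x = h (zpow h j x).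
Proof.
case: j => n; first by rewrite -PoszD addn1.
have -> : Negz n + 1 = - n%:Z by rewrite NegzE -[n.+1]addn1 PoszD opprD addrNK.
case: n => [|n]; first by rewrite /= homeo_invK.
by rewrite -[- _]/(Negz n) /= homeo_invK.
Qed.

Lemma zpowP j x : zpow h (j - 1) x = homeo_inv h (zpow h j x).
Proof. by rewrite -{2}(subrK 1 j) zpowS homeo_funK. Qed.

Lemma zpowD j k x : zpow h (j + k) x = zpow h j (zpow h k x).
Proof.
elim/int_ind: j => [|n IH|n IH]; first by rewrite add0r.
  by rewrite -addn1 PoszD addrAC !zpowS IH.
by rewrite -addn1 PoszD opprD addrAC !zpowP IH.
Qed.

Lemma zpowNK j : cancel (zpow h j) (zpow h (- j)).
Proof. by move=> x; rewrite -zpowD addNr. Qed.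

Lemma zpowKN j : cancel (zpow h (- j)) (zpow h j).
Proof. by move=> x; rewrite -zpowD subrr. Qed.

Lemma zpow_continuous j : continuous (zpow h j).
Proof.
have it (g : X -> X) n : continuous g -> continuous (iter n g).
  move=> cg; elim: n => [|n IH] x /=; first exact: cvg_id.
  by apply: (@continuous_comp _ _ _ (iter n g) g); [exact: IH|exact: cg].
case: j => n; first exact/it/homeo_fun_cont.
exact/(it (homeo_inv h) n.+1)/homeo_inv_cont.
Qed.

Definition zpow_homeo j : homeo X X := Homeo (zpowNK j) (zpowKN j)
  (@zpow_continuous j) (@zpow_continuous (- j)).

End Zpow.

Lemma zpow_conj (X Y : topologicalType) (h : homeo X X) (k : homeo Y Y) (u : X -> Y) e :
  (forall x, u (h x) = zpow k e (u x)) ->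
  forall j x, u (zpow h j x) = zpow k (e * j) (u x).
Proof.
move=> uh; elim/int_ind => [|n IH|n IH] x; first by rewrite mulr0.
  by rewrite -addn1 PoszD zpowS uh IH mulrDr mulr1 addrC zpowD.
rewrite -addn1 PoszD opprD zpowP mulrBr mulr1 addrC zpowD -IH.
by rewrite -{2}(homeo_invK h (zpow h (- n%:Z) x)) uh zpowNK.
Qed.

Definition homeo_comp (X Y Z : topologicalType) (v : homeo Y Z) (u : homeo X Y) :
  homeo X Z.
Proof.
apply: (@Homeo _ _ (v \o u) (homeo_inv u \o homeo_inv v)).
- by move=> x /=; rewrite !homeo_funK.
- by move=> x /=; rewrite !homeo_invK.
- by move=> x; apply: continuous_comp; exact: homeo_fun_cont.
- by move=> x; apply: continuous_comp; exact: homeo_inv_cont.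
Defined.

Definition homeo_sym (X Y : topologicalType) (u : homeo X Y) : homeo Y X :=
  Homeo (homeo_invK u) (homeo_funK u) (@homeo_inv_cont _ _ u) (@homeo_fun_cont _ _ u).

Lemma homeo_inj (X Y : topologicalType) (u : homeo X Y) : injective u.
Proof. exact: can_inj (homeo_funK u). Qed.

Lemma homeo_image (X Y : topologicalType) (u : homeo X Y) (A : set X) :
  u @` A = homeo_inv u @^-1` A.
Proof.
apply/seteqP; split => [_ [x Ax <-] /=|y Ay]; first by rewrite homeo_funK.
by exists (homeo_inv u y); rewrite ?homeo_invK.
Qed.

Lemma homeo_interior (X Y : topologicalType) (u : homeo X Y) (A : set X) :
  (u @` A)° = u @` A°.
Proof.
apply/seteqP; split => [y uAy|_ [x Ax <-]].
  exists (homeo_inv u y); last exact: homeo_invK.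
  have := @homeo_fun_cont _ _ u (homeo_inv u y).
  rewrite /continuous_at homeo_invK => /(_ _ uAy) uAx.
  by apply: (@filterS _ (nbhs (homeo_inv u y)) _ _ _ _ uAx) => x [x' Ax'] /homeo_inj <-.
rewrite /interior homeo_image; apply: (@homeo_inv_cont _ _ u).
by rewrite homeo_funK.
Qed.

(** Conjugation by ft is an automorphism of the deck group.  This group is
    infinite cyclic, so the generator h is sent to h or to its inverse. *)
Lemma lift_conj_shift (L S : topologicalType) (q : L -> S) (h : homeo L L)
    (f : homeo S S) (ft : homeo L L) :
  regular_Z_cover q h -> is_lift q f ft ->
  exists e : int, e * e = 1 /\ forall k x, ft (zpow h k x) = zpow h (e * k) (ft x).
Proof.
move=> [_ deck _ faithful] lift.
have qh x : q (h x) = q x by apply/(deck h).2; exists 1.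
have [e He] : exists e, homeo_comp ft (homeo_comp h (homeo_sym ft)) =1 zpow h e.
  by apply/deck => x /=; rewrite lift qh -lift homeo_invK.
have [e' He'] : exists e, homeo_comp (homeo_sym ft) (homeo_comp h ft) =1 zpow h e.
  apply/deck => x /=; apply: (@homeo_inj _ _ f).
  by rewrite -lift homeo_invK qh lift.
have fth x : ft (h x) = zpow h e (ft x) by rewrite -He /= homeo_funK.
have ftVh x : homeo_inv ft (h x) = zpow h e' (homeo_inv ft x).
  by rewrite -He' /= homeo_invK.
exists e; split; last exact: zpow_conj.
have ee' : e' * e = 1.
  apply/eqP; rewrite -subr_eq0; apply/eqP/faithful => x.
  rewrite addrC zpowD.
  have -> : zpow h (e' * e) x = h x.
    by rewrite -(homeo_funK ft (h x)) fth (zpow_conj ftVh) homeo_funK.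
  exact: (homeo_funK h).
have : (`|e'| * `|e|)%N == 1%N by rewrite -abszM ee'.
rewrite muln_eq1 => /andP[_ /eqP e1].
by case: e e1 {He fth ee'} => [[|[|]]|[|]].
Qed.

Section Symmetry.
Context {R : realType} {L : topologicalType} (h : homeo L L) (ft : homeo L L).
Context {m : nat} (R0 : 'I_m -> set L).

Lemma lifted_rect_shift k a :
  lifted_rect h R0 (shift k a) = zpow h k @` lifted_rect h R0 a.
Proof.
rewrite /lifted_rect /= image_comp; congr (_ @` _); apply/funext => x.
by rewrite /shift /= addrC zpowD.
Qed.

Lemma coding_matrix_shift e k a b :
  (forall k x, ft (zpow h k x) = zpow h (e * k) (ft x)) ->
  coding_matrix R ft h R0 (shift k a) (shift (e * k) b) = coding_matrix R ft h R0 a b.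
Proof.
move=> ftk; rewrite /coding_matrix !lifted_rect_shift.
rewrite (homeo_interior (zpow_homeo h k)) (homeo_interior (zpow_homeo h (e * k))) /=.
congr ((asbool _)%:R); apply/propext; split => [[_ [[_ [x Ax <-] <-] [y By]]]|[_ [[x Ax <-] Bx]]].
  rewrite ftk => /(can_inj (zpowNK h _)) yx; exists (ft x).
  by split; [exists x | rewrite -yx].
by exists (zpow h (e * k) (ft x)); split; [exists (zpow h k x) => //; exists x | exists (ft x)].
Qed.

End Symmetry.

(** * Intervals and connected sets *)

Section IntervalInduction.
Context {R : realType}.

(** Compactness of a segment in the form of an induction principle, for a
    property of subintervals: from the small ones to the whole by concatenation.
    It serves to lift squares, to develop verticals and to make local bounds
    uniform. *)
Lemma interval_induction (P : R -> R -> Prop) (a b : R) : a <= b ->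
  (forall c, a <= c <= b -> exists2 d, 0 < d & forall s t,
     a <= s -> s <= t -> t <= b -> `|s - c| < d -> `|t - c| < d -> P s t) ->
  (forall s t u, a <= s -> s <= t -> t <= u -> u <= b -> P s t -> P t u -> P s u) ->
  P a b.
Proof.
move=> ab loc tr.
pose T := [set t | a <= t <= b /\ P a t].
have Ta : T a.
  split; first by rewrite lexx.
  by have [|d d0] := loc a; [rewrite lexx|apply; rewrite ?lexx ?subrr ?normr0].
have supT : has_sup T by split; [exists a | exists b => t [/andP[]]].
pose c := sup T.
have ac : a <= c by exact: ub_le_sup supT.2 _ Ta.
have cb : c <= b by apply: ge_sup; [exists a | move=> t [/andP[]]].
have [|d d0 near_c] := loc c; first by rewrite ac.
have [t [/andP[at_ tb] Pat] ct] := sup_adherent d0 supT.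
have tc : t <= c by apply: ub_le_sup supT.2 _ _; split=> //; rewrite at_.
have step u : c <= u -> u <= b -> u < c + d -> P a u.
  move=> cu ub uc; apply: (tr a t u) => //; first exact: le_trans cu.
  apply: near_c => //; first exact: le_trans cu.
    by rewrite ler0_norm ?subr_le0// opprB ltrBlDr -ltrBlDl.
  by rewrite ger0_norm ?subr_ge0// ltrBlDl.
have [<-|ltcb] := eqVneq c b; first by apply: step; rewrite ?ltrDl.
have {}ltcb : c < b by rewrite lt_neqAle ltcb.
pose u := Num.min b (c + d / 2).
have cu : c < u by rewrite lt_min ltcb ltrDl divr_gt0.
have : u <= c.
  apply: ub_le_sup supT.2 _ _; split; first by rewrite (le_trans ac (ltW cu)) ge_min lexx.
  apply: step; [exact: ltW | by rewrite ge_min lexx |].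
  by rewrite gt_min ltrD2l ltr_pdivrMr// ltr_pMr// ltr1n orbT.
by rewrite leNgt cu.
Qed.

Lemma locally_constant (T : Type) (g : R -> T) (a b : R) : a <= b ->
  (forall c, a <= c <= b -> \forall s \near c, a <= s <= b -> g s = g c) ->
  g a = g b.
Proof.
move=> ab loc; apply: (interval_induction (P := fun s t => g s = g t)) => //.
  move=> c cab; have /nbhs_ballP[d d0 near_c] := loc c cab.
  exists d => // s t as_ st tb sc tc.
  rewrite (near_c s) /ball/= ?(distrC c)// ?as_ ?(le_trans st)//.
  by rewrite (near_c t) /ball/= ?(distrC c)// tb (le_trans as_).
by move=> s t u _ _ _ _ -> ->.
Qed.

End IntervalInduction.

Section Within.

Lemma within_comp (X Y Z : topologicalType) (D : set X) (E : set Y)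
    (f : X -> Y) (g : Y -> Z) :
  {within D, continuous f} -> {within E, continuous g} ->
  (forall x, D x -> E (f x)) -> {within D, continuous (g \o f)}.
Proof.
move=> /subspace_continuousP fD /subspace_continuousP gE DE.
apply/subspace_continuousP => x Dx W /(gE _ (DE x Dx)) gW.
have fW : \forall y \near x, D y -> E (f y) -> W (g (f y)) by exact: (fD x Dx _ gW).
suff : \forall y \near x, D y -> W (g (f y)) by [].
by apply: filterS fW => y fy Dy; apply: fy => //; exact: DE.
Qed.

Lemma connected_locally_constant (X : topologicalType) (D : set X)
    (Q : X -> Prop) x0 :
  connected D -> D x0 -> Q x0 ->
  (forall x, D x -> \forall y \near x, D y -> (Q y <-> Q x)) ->
  forall x, D x -> Q x.
Proof.
move=> conn Dx0 Qx0 loc.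
suff <- : D `&` [set x | Q x] = D by move=> x [].
apply: conn; first by exists x0.
- exists [set y | D y -> Q y]°; first exact: open_interior.
  apply/seteqP; split => x [Dx] /=.
    move=> Qx; split => //; apply: filterS (loc x Dx) => y yx Dy.
    by apply/(yx Dy).
  by move=> /nbhs_singleton/(_ Dx) Qx; split.
- exists (~` [set y | D y -> ~ Q y]°); first exact/open_closedC/open_interior.
  apply/seteqP; split => x [Dx] /=.
    by move=> Qx; split => // /nbhs_singleton/(_ Dx).
  move=> nQ; split => //; apply: contrapT => nQx; apply: nQ.
  by apply: filterS (loc x Dx) => y yx Dy /(yx Dy).
Qed.

(** A continuous injection of a compact set in a Hausdorff space is an embedding:
    the image of the complement of a neighbourhood is closed. *)
Lemma compact_factor (X S Z : topologicalType) (K : set X) (g : X -> S)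
    (D : set Z) (c : Z -> S) (t : Z -> X) :
  hausdorff_space S -> compact K -> {within K, continuous g} ->
  {in K &, injective g} -> {within D, continuous c} ->
  (forall z, D z -> K (t z) /\ g (t z) = c z) -> {within D, continuous t}.
Proof.
move=> hS cK gK inj_g /subspace_continuousP cD tK.
apply/subspace_continuousP => z Dz W Wz.
have [Kz gz] := tK z Dz.
pose K' := K `\` W°.
have sub : K' `<=` K by move=> x [].
have cK' : compact K'.
  by rewrite /K' setDE; apply: compact_closedI => //; apply/open_closedC/open_interior.
have clK' : closed (g @` K').
  apply: compact_closed => //; apply: continuous_compact => //.
  exact: continuous_subspaceW gK.
have : nbhs (c z) (~` (g @` K')).
  apply: open_nbhs_nbhs; split; first exact: closed_openC.
  move=> [x [Kx nWx] gx]; apply: nWx.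
  by rewrite (inj_g x (t z)) ?inE// gz.
move=> /(cD z Dz) cW.
have {}cW : \forall y \near z, D y -> ~ (g @` K') (c y) by exact: cW.
suff : \forall y \near z, D y -> W (t y) by [].
apply: filterS cW => y cy Dy.
have [Ky gy] := tK y Dy; apply: contrapT => nW; apply: (cy Dy).
by exists (t y) => //; split => // /interior_subset.
Qed.

End Within.

(** * Lifting rectangles to the cover *)

Section Covering.
Context {L S : topologicalType} (q : L -> S).
Hypothesis cov : covering q.

(** That two lifts agree is a locally constant property: over an evenly covered
    open set they are in the same sheet or in disjoint ones. *)
Lemma lift_unique (X : topologicalType) (D : set X) (u v : X -> L) x0 :
  connected D -> {within D, continuous u} -> {within D, continuous v} ->
  D x0 -> u x0 = v x0 -> (forall x, D x -> q (u x) = q (v x)) ->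
  forall x, D x -> u x = v x.
Proof.
move=> conn /subspace_continuousP uD /subspace_continuousP vD Dx0 uv0 quv.
have [_ _ ev] := cov.
apply: (connected_locally_constant conn Dx0 uv0) => x Dx.
have [U [sheets [oU Us qU disj homeo_sheets]]] := ev (q (u x)).
have : (q @^-1` U) (u x) by [].
have : (q @^-1` U) (v x) by rewrite /= -quv.
rewrite !qU => -[V2 sV2 vV2] [V1 sV1 uV1].
have [[oV1 inj1 _ _] _] := homeo_sheets _ sV1.
have [[oV2 inj2 _ _] _] := homeo_sheets _ sV2.
have near1 : \forall y \near x, D y -> V1 (u y) :=
  uD x Dx _ (open_nbhs_nbhs (conj oV1 uV1)).
have near2 : \forall y \near x, D y -> V2 (v y) :=
  vD x Dx _ (open_nbhs_nbhs (conj oV2 vV2)).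
have [E|neV] := pselect (V1 = V2).
  subst V2; have -> : (u x = v x) = True.
    by apply/propext; split => // _; apply: inj1; rewrite ?inE// quv.
  apply: filterS2 near1 near2 => y uy vy Dy; split => // _.
  by apply: inj1; rewrite ?inE ?quv//; [exact: uy|exact: vy].
apply: filterS2 near1 near2 => y uy vy Dy.
by split => E; exfalso; apply: neV; apply: disj => //;
  [exists (u y); split; [exact: uy|rewrite E; exact: vy]|exists (u x); split; rewrite // E].
Qed.

Lemma local_section s : exists U : set S, exists sec : S -> L,
  [/\ open U, U s, {within U, continuous sec} & forall z, U z -> q (sec z) = z].
Proof.
have [_ surj ev] := cov.
have [x _ xs] : range q s by rewrite surj.
have [U [sheets [oU Us qU disj homeo_sheets]]] := ev s.
have : (q @^-1` U) x by rewrite /= xs.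
rewrite qU => -[V sV Vx].
have [[oV inj _ open_q] qV] := homeo_sheets _ sV.
pose sec z := xget x [set y | V y /\ q y = z].
have secP z : U z -> V (sec z) /\ q (sec z) = z.
  rewrite -qV => -[y Vy qy]; rewrite /sec; case: xgetP => [w _ //|/(_ y)].
  by move=> /not_andP[].
exists U, sec; split => //; last by move=> z /secP[].
apply/subspace_continuousP => z Uz W Wz.
have [Vz qz] := secP z Uz.
have oVW : open (V `&` W°) by apply: openI => //; exact: open_interior.
have : nbhs z (q @` (V `&` W°)).
  apply: open_nbhs_nbhs; split; first by apply: open_q => // y [].
  by exists (sec z).
move=> near_qVW; suff : \forall z' \near z, U z' -> W (sec z') by [].
apply: filterS near_qVW => z' [y [Vy Wy] qy] Uz'.
have [Vz' qz'] := secP z' Uz'.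
suff -> : sec z' = y by exact: interior_subset.
by apply: inj; rewrite ?inE// qz'.
Qed.

End Covering.

Lemma pair_continuous (X Y Z : topologicalType) (f : X -> Y) (g : X -> Z) :
  continuous f -> continuous g -> continuous (fun x => (f x, g x)).
Proof. by move=> cf cg x; exact: (cvg_pair (cf x) (cg x)). Qed.

Section SquareLift.
Context {R : realType} {L S : topologicalType} (q : L -> S) (h : homeo L L).
Hypotheses (cover : regular_Z_cover q h) (connL : connected [set: L]).

Let cov : covering q. Proof. by case: cover. Qed.

Lemma q_zpow j x : q (zpow h j x) = q x.
Proof.
by have [_ deck _ _] := cover; apply: (deck (zpow_homeo h j)).2; exists j.
Qed.

(** A deck transformation that fixes a point and the identity are two lifts of q
    that agree at this point. *)
Lemma zpow_free j k x : zpow h j x = zpow h k x -> j = k.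
Proof.
move=> jk; have [_ _ _ faithful] := cover.
apply/eqP; rewrite -subr_eq0; apply/eqP/faithful.
have fix_x : zpow h (j - k) x = x by rewrite addrC zpowD jk zpowNK.
move=> y; apply: (@lift_unique _ _ _ cov _ [set: L] (zpow h (j - k)) id x) => //.
- exact/continuous_subspaceT/zpow_continuous.
- by apply: continuous_subspaceT => z; exact: cvg_id.
- by move=> z _; rewrite q_zpow.
Qed.

Variable g : R * R -> S.
Hypothesis g_cont : continuous g.

Definition liftable (D : set (R * R)) :=
  exists2 sg : R * R -> L, {within D, continuous sg} & forall z, D z -> q (sg z) = g z.

Definition box (s t u v : R) : set (R * R) :=
  [set z | (s <= z.1 <= t) /\ (u <= z.2 <= v)].

Lemma boxE s t u v : box s t u v = `[s, t] `*` `[u, v].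
Proof.
by apply/seteqP; split => z /=; rewrite !in_itv.
Qed.

Lemma closed_box s t u v : closed (box s t u v).
Proof.
have -> : box s t u v = fst @^-1` `[s, t] `&` snd @^-1` `[u, v].
  by apply/seteqP; split => z /=; rewrite !in_itv.
apply: closedI; apply: closed_comp; try exact: interval_closed.
  by move=> z _; exact: cvg_fst.
by move=> z _; exact: cvg_snd.
Qed.

(** A deck transformation makes the two lifts agree at z0, hence on the connected
    intersection. *)
Lemma liftable_glue (D1 D2 : set (R * R)) z0 : closed D1 -> closed D2 ->
  connected (D1 `&` D2) -> (D1 `&` D2) z0 ->
  liftable D1 -> liftable D2 -> liftable (D1 `|` D2).
Proof.
move=> cl1 cl2 conn D12 [s1 s1c s1q] [s2 s2c s2q].
have [_ _ fibre _] := cover.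
have [|j js] := fibre (s2 z0) (s1 z0); first by rewrite s1q ?s2q; case: D12.
pose s2' := zpow h j \o s2.
have s2'c : {within D2, continuous s2'}.
  apply: (within_comp (E := setT) s2c) => //.
  exact/continuous_subspaceT/zpow_continuous.
have agree z : (D1 `&` D2) z -> s1 z = s2' z.
  move=> D12z; apply: (@lift_unique _ _ _ cov _ _ s1 s2' z0 conn) => //.
  - by apply: continuous_subspaceW s1c => ? [].
  - by apply: continuous_subspaceW s2'c => ? [].
  - by move=> x [D1x D2x]; rewrite /s2' /= q_zpow s1q ?s2q.
pose s z := if pselect (D1 z) then s1 z else s2' z.
exists s.
  apply: withinU_continuous => //.
    apply: (@subspace_eq_continuous _ D1 _ s1) => // z; rewrite inE => D1z.
    by rewrite /s /from_subspace; case: (pselect (D1 z)).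
  apply: (@subspace_eq_continuous _ D2 _ s2') => // z; rewrite inE => D2z.
  by rewrite /s /from_subspace; case: (pselect (D1 z)) => // D1z; rewrite agree.
move=> z D12z; rewrite /s; case: (pselect (D1 z)) => [/s1q//|nD1].
by rewrite /s2' /= q_zpow s2q//; case: D12z.
Qed.

Lemma liftable_local p : exists2 d : R, 0 < d & forall D : set (R * R),
  (forall z, D z -> `|z.1 - p.1| < d /\ `|z.2 - p.2| < d) -> liftable D.
Proof.
have [U [sec [oU Up secc secq]]] := local_section cov (g p).
have : \forall z \near p, U (g z) by apply: g_cont; apply: open_nbhs_nbhs.
move=> /nbhs_ballP[d d0 near_p]; exists d => // D Dp.
have DU z : D z -> U (g z).
  by move=> /Dp[z1 z2]; apply: near_p; split; rewrite /ball /= distrC.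
exists (sec \o g); last by move=> z /DU/secq.
apply: (within_comp _ secc DU).
exact: continuous_subspaceT.
Qed.

Lemma connected_vedge t u v : connected (box t t u v).
Proof.
have -> : box t t u v = (fun y => (t, y)) @` `[u, v].
  apply/seteqP; split => [[x y] [/= xt yuv]|_ [y + <-]] /=; last first.
    by rewrite /= in_itv /= => ?; rewrite /box /= lexx.
  by exists y; rewrite /= ?in_itv//; congr (_, _); apply/le_anti.
apply: connected_continuous_connected; first exact: segment_connected.
by apply/continuous_subspaceT/pair_continuous => y; [exact: cvg_cst|exact: cvg_id].
Qed.

Lemma connected_hedge s t v : connected (box s t v v).
Proof.
have -> : box s t v v = (fun x => (x, v)) @` `[s, t].
  apply/seteqP; split => [[x y] [/= xst yv]|_ [x + <-]] /=; last first.
    by rewrite /= in_itv /= => ?; rewrite /box /= lexx.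
  by exists x; rewrite /= ?in_itv//; congr (_, _); apply/le_anti.
apply: connected_continuous_connected; first exact: segment_connected.
by apply/continuous_subspaceT/pair_continuous => y; [exact: cvg_id|exact: cvg_cst].
Qed.

(** The square is cut in strips and each strip in boxes that are mapped in evenly
    covered sets: two nested interval inductions. *)
Lemma liftable_square : liftable (@unit_square R).
Proof.
rewrite (_ : unit_square = box 0 1 0 1)//.
apply: (interval_induction (P := fun s t => liftable (box s t 0 1))) => //.
  move=> c _.
  have [d d0 strip] : exists2 d : R, 0 < d & forall s t, s <= t ->
      `|s - c| < d -> `|t - c| < d -> liftable (box s t 0 1).
    apply: (interval_induction (P := fun u v => exists2 d : R, 0 < d &
      forall s t, s <= t -> `|s - c| < d -> `|t - c| < d -> liftable (box s t u v))) => //.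
      move=> e _; have [d d0 loc] := liftable_local (c, e).
      exists d => // u v _ uv _ ue ve; exists d => // s t st sc tc.
      apply: loc => -[x y] [/= /andP[sx xt] /andP[uy yv]].
      by move: sc tc ue ve; rewrite !ltr_norml => /andP[? ?] /andP[? ?] /andP[? ?] /andP[? ?];
        split; apply/andP; split; lra.
    move=> u v w _ uv vw _ [d d0 P1] [d' d'0 P2].
    exists (Num.min d d'); first by rewrite lt_min d0.
    move=> s t st; rewrite !lt_min => /andP[sd sd'] /andP[td td'].
    have -> : box s t u w = box s t u v `|` box s t v w.
      apply/seteqP; split => [[x y] [/= xst /andP[uy yw]]|[x y] /= [[? /andP[uy yv]]|[? /andP[vy yw]]]].
      - by have [yv|vy] := leP y v; [left|right]; rewrite /box /= ?uy ?yv ?(ltW vy).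
      - by rewrite /box /= uy (le_trans yv vw).
      - by rewrite /box /= yw (le_trans uv vy).
    apply: (liftable_glue (z0 := (s, v))); try exact: closed_box.
    - rewrite (_ : _ `&` _ = box s t v v); first exact: connected_hedge.
      apply/seteqP; split => [[x y] [[/= ? /andP[? ?]] [_ /= /andP[? ?]]]|[x y] [/= ? /andP[vy yv]]].
        by split => //=; apply/andP.
      by split; split => //=; apply/andP; split => //; [exact: le_trans vy|exact: le_trans vw].
    - by split; split; rewrite /= !lexx ?st ?uv ?vw.
    - exact: P1.
    - exact: P2.
  exists d => // s t _ st _; exact: strip.
move=> s t u _ st tu _ P1 P2.
have -> : box s u 0 1 = box s t 0 1 `|` box t u 0 1.
  apply/seteqP; split => [[x y] [/= /andP[sx xu] y01]|[x y] /= [[/andP[sx xt] ?]|[/andP[tx xu] ?]]].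
  - by have [xt|tx] := leP x t; [left|right]; rewrite /box /= ?sx ?xt ?(ltW tx).
  - by rewrite /box /= sx (le_trans xt tu).
  - by rewrite /box /= xu (le_trans st tx).
apply: (liftable_glue (z0 := (t, 0))) => //; try exact: closed_box.
- rewrite (_ : _ `&` _ = box t t 0 1); first exact: connected_vedge.
  apply/seteqP; split => [[x y] [[/= /andP[? ?] ?] [/= /andP[? ?] _]]|[x y] [/= /andP[tx xt] ?]].
    by split => //=; apply/andP.
  by split; split => //=; apply/andP; split => //; [exact: le_trans tx|exact: le_trans tu].
- by split; split; rewrite /= ?lexx ?st ?tu ?ler01.
Qed.

End SquareLift.

Section Clamp.
Context {R : realType}.

(** Retraction on the unit interval; it extends to the plane a map defined on the
    square. *)
Definition clamp (x : R) : R := Num.max 0 (Num.min 1 x).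

Lemma clamp_itv x : 0 <= clamp x <= 1.
Proof. by rewrite /clamp le_max lexx /= ge_max ler01 ge_min lexx. Qed.

Lemma clamp_id x : 0 <= x <= 1 -> clamp x = x.
Proof. by move=> /andP[x0 x1]; rewrite /clamp (min_idPr x1) (max_idPr x0). Qed.

Lemma clamp_continuous : continuous clamp.
Proof.
move=> x; apply: continuous_max; first exact: cvg_cst.
by apply: continuous_min; [exact: cvg_cst | exact: cvg_id].
Qed.

Lemma compact_square : compact (@unit_square R).
Proof.
rewrite (_ : unit_square = box 0 1 0 1)// boxE; apply: compact_setX; exact: segment_compact.
Qed.

End Clamp.

Section RectangleLift.
Context {R : realType} {L S : topologicalType} (q : L -> S) (h : homeo L L).
Hypotheses (cover : regular_Z_cover q h) (hS : hausdorff_space S).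
Variable rho : R * R -> S.
Hypotheses (rho_cont : {within unit_square, continuous rho})
  (rho_inj : {in unit_square &, injective rho}).

Let cov : covering q. Proof. by case: cover. Qed.

Lemma rectangle_lift : exists2 sg : R * R -> L,
  {within unit_square, continuous sg} & forall z, unit_square z -> q (sg z) = rho z.
Proof.
pose c (z : R * R) := (clamp z.1, clamp z.2).
have sq_c z : unit_square (c z) by split; exact: clamp_itv.
have cc : continuous c.
  apply: pair_continuous => z.
    by apply: continuous_comp; [exact: cvg_fst|exact: clamp_continuous].
  by apply: continuous_comp; [exact: cvg_snd|exact: clamp_continuous].
have rc : continuous (rho \o c).
  apply/continuous_subspace_setT; apply: (within_comp _ rho_cont) => //.
  exact: continuous_subspaceT.
have [sg sgc sgq] := liftable_square cover rc.
exists sg => // -[x y] sqz; rewrite sgq// /c /=.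
by case: sqz => /= x01 y01; rewrite !clamp_id.
Qed.

Definition rect_coord (s : S) : R * R := xget (0, 0) [set z | unit_square z /\ rho z = s].

Lemma rect_coordP s : rect rho s -> unit_square (rect_coord s) /\ rho (rect_coord s) = s.
Proof.
move=> [z sqz rz]; rewrite /rect_coord; case: xgetP => [w _ //|/(_ z)].
by move=> /not_andP[].
Qed.

Lemma rect_coordK z : unit_square z -> rect_coord (rho z) = z.
Proof.
move=> sqz; have [|sqc rc] := @rect_coordP (rho z); first by exists z.
by apply: rho_inj; rewrite ?inE.
Qed.

Lemma rect_coord_continuous : {within rect rho, continuous rect_coord}.
Proof.
apply: (compact_factor (K := unit_square) (g := rho) (c := id)) => //.
- exact: compact_square.
- by apply: continuous_subspaceT => s; exact: cvg_id.
- exact: rect_coordP.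
Qed.

(** On K, the identity and the map that goes down by q and up by sg are two lifts
    of q, and they agree at one point. *)
Lemma rectangle_sheet (sg : R * R -> L) (K : set L) :
  {within unit_square, continuous sg} ->
  (forall z, unit_square z -> q (sg z) = rho z) ->
  connected K -> (forall x, K x -> rect rho (q x)) ->
  (K `&` (sg @` unit_square)) !=set0 -> K `<=` sg @` unit_square.
Proof.
move=> sgc sgq conn Krect [x0 [Kx0 [z0 sqz0 sgz0]]].
have cq : continuous q by case: cov.
suff r x : K x -> sg (rect_coord (q x)) = x.
  by move=> x Kx; rewrite -(r x Kx); exists (rect_coord (q x)) => //; case: (rect_coordP (Krect x Kx)).
move=> Kx; apply: (@lift_unique _ _ _ cov _ K (sg \o rect_coord \o q) id x0) => //.
- apply: (within_comp (E := unit_square) _ sgc); last by move=> y /Krect/rect_coordP[].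
  apply: (within_comp _ rect_coord_continuous) => //.
  exact: continuous_subspaceT.
- by apply: continuous_subspaceT => y; exact: cvg_id.
- by rewrite -sgz0 /= sgq// rect_coordK.
- by move=> y /Krect/rect_coordP[? ?]; rewrite /= sgq.
Qed.

(** R0 is connected, so it lies in the sheet of one of its points; this sheet is
    already a bijective copy of the rectangle. *)
Lemma lifted_rectangle_param (R0 : set L) : connected R0 ->
  set_bij R0 (rect rho) q -> exists sg : R * R -> L,
  [/\ {within unit_square, continuous sg},
      forall z, unit_square z -> q (sg z) = rho z & sg @` unit_square = R0].
Proof.
move=> conn [maps _ surj].
have sq0 : unit_square ((0, 0) : R * R) by split; rewrite /= lexx ler01.
have [x0 R0x0 qx0] : (q @` R0) (rho (0, 0)) by apply: surj; exists (0, 0).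
have [sg sgc sgq] := rectangle_lift.
have [_ _ fibre _] := cover.
have [|j x0j] := fibre (sg (0, 0)) x0; first by rewrite sgq.
pose sg' := zpow h j \o sg.
have sgc' : {within unit_square, continuous sg'}.
  apply: (within_comp (E := setT) sgc) => //.
  exact/continuous_subspaceT/zpow_continuous.
have sgq' z : unit_square z -> q (sg' z) = rho z.
  by move=> sqz; rewrite /sg' /= (q_zpow cover) sgq.
have sub : R0 `<=` sg' @` unit_square.
  apply: (rectangle_sheet sgc' sgq') => //.
  by exists x0; split => //; exists (0, 0).
exists sg'; split => //; apply/seteqP; split => // _ [z sqz <-].
have [x R0x qx] : (q @` R0) (rho z) by apply: surj; exists z.
have [z' sqz' zx] := sub _ R0x.
suff <- : z' = z by rewrite zx.
by apply: rho_inj; rewrite ?inE// -sgq'// zx.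
Qed.

End RectangleLift.

(** The lift of K in the sheet of the rectangle (i, j) is connected, and so is its
    image under ft; the latter is over the rectangle i', hence in one sheet. *)
Lemma lifted_rect_unique (R : realType) (L S : topologicalType) (q : L -> S)
    (h : homeo L L) (f : homeo S S) (ft : homeo L L) (m : nat)
    (rho : 'I_m -> R * R -> S) (R0 : 'I_m -> set L) (i i' : 'I_m) (j j' j'' : int)
    (K : set S) (x y : L) :
  hausdorff_space S -> connected [set: L] -> regular_Z_cover q h -> is_lift q f ft ->
  (forall i, {within unit_square, continuous (rho i)}) ->
  (forall i, {in unit_square &, injective (rho i)}) ->
  (forall i, connected (R0 i) /\ set_bij (R0 i) (rect (rho i)) q) ->
  connected K -> K `<=` rect (rho i) -> (forall s, K s -> rect (rho i') (f s)) ->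
  K (q x) -> K (q y) -> lifted_rect h R0 (i, j) x -> lifted_rect h R0 (i, j) y ->
  lifted_rect h R0 (i', j') (ft x) -> lifted_rect h R0 (i', j'') (ft y) -> j' = j''.
Proof.
move=> hS connL cover lift rho_cont rho_inj R0P connK Ki Ki' Kx Ky.
have param a : exists sg : R * R -> L, [/\ {within unit_square, continuous sg},
      forall z, unit_square z -> q (sg z) = rho a.1 z &
      sg @` unit_square = lifted_rect h R0 a].
  have [conn bij] := R0P a.1.
  have [sg [sgc sgq sgR]] := lifted_rectangle_param cover hS (rho_cont a.1) (@rho_inj a.1) conn bij.
  exists (zpow h a.2 \o sg); split.
  - apply: (within_comp (E := setT) sgc) => //.
    exact/continuous_subspaceT/zpow_continuous.
  - by move=> z sqz; rewrite /= (q_zpow cover) sgq.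
  - by rewrite -image_comp sgR.
have [sg [sgc sgq sgR]] := param (i, j).
have [sg' [sgc' sgq' sgR']] := param (i', j').
rewrite -sgR => -[z sqz zx] [w sqw wy] ftx fty.
pose s := sg \o rect_coord (rho i).
pose K2 := (ft \o s) @` K.
have qs p : K p -> q (s p) = p.
  by move=> /Ki/rect_coordP[? ?]; rewrite /s /= sgq.
have sx : s (q x) = x.
  by rewrite /s /= -zx sgq//= rect_coordK//; exact: rho_inj.
have sy : s (q y) = y.
  by rewrite /s /= -wy sgq//= rect_coordK//; exact: rho_inj.
have connK2 : connected K2.
  apply: connected_continuous_connected => //.
  apply: (within_comp (E := setT)) => //; last first.
    exact/continuous_subspaceT/homeo_fun_cont.
  apply: (within_comp _ sgc); last by move=> p /Ki/rect_coordP[].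
  apply: continuous_subspaceW Ki _.
  exact: (rect_coord_continuous hS (rho_cont i) (@rho_inj i)).
have sub : K2 `<=` sg' @` unit_square.
  apply: (rectangle_sheet cover hS (rho_cont i') (@rho_inj i') sgc' sgq') => //.
    by move=> _ [p Kp <-]; rewrite /= lift qs//; exact: Ki'.
  by exists (ft x); split; [exists (q x); rewrite //= sx | rewrite sgR'].
have : lifted_rect h R0 (i', j') (ft y).
  by rewrite -sgR'; apply: sub; exists (q y); rewrite //= sy.
move: fty => [u Ru uy] [v Rv vy].
have [_ bij] := R0P i'; have uv : u = v.
  apply: (set_bij_inj bij); rewrite ?inE//.
  by rewrite -(q_zpow cover j'' u) -[in RHS](q_zpow cover j' v) [X in q X]uy vy.
by subst v; apply: (zpow_free cover connL (x := u)); rewrite [LHS]vy [RHS]uy.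
Qed.

(** * Lengths of transverse paths *)

Section RealAux.
Context {R : realType}.

Lemma avoid_finite (B : set R) (s t : R) : finite_set B -> s < t ->
  exists2 r, s < r < t & ~ B r.
Proof.
move=> /finite_seqP[l ->] st.
suff [s' [t' [ss' st' tt' free]]] : exists s' t', [/\ s <= s', s' < t', t' <= t &
    forall r, s' < r < t' -> r \notin l].
  have mid : s' < (s' + t') / 2 < t' by apply/andP; split; lra.
  exists ((s' + t') / 2); last exact/negP/free.
  by case/andP: mid => ? ?; rewrite (le_lt_trans ss')// (lt_le_trans _ tt').
elim: l => [|x l [s' [t' [ss' st' tt' free]]]]; first by exists s, t.
have [xm|mx] := leP x ((s' + t') / 2).
  exists ((s' + t') / 2), t'; split => //; [lra|lra|] => r /andP[mr rt'].
  rewrite inE negb_or free ?rt' ?andbT; first by rewrite gt_eqF// (le_lt_trans xm).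
  by lra.
exists s', ((s' + t') / 2); split => //; [lra|lra|] => r /andP[s'r rm].
rewrite inE negb_or free ?s'r ?andbT /=; first by rewrite lt_eqF// (lt_trans rm).
by lra.
Qed.

Lemma inj_strict_mono (f : R -> R) (a b : R) :
  {within `[a, b], continuous f} -> {in `[a, b] &, injective f} ->
  exists e : bool, forall x y, a <= x -> x < y -> y <= b ->
    (-1) ^+ e * f x < (-1) ^+ e * f y.
Proof.
move=> fc finj; have mem x y : a <= x -> x < y -> y <= b ->
    (x \in `[a, b]) * (y \in `[a, b]).
  move=> ax xy yb; rewrite !in_itv /= ax yb (le_trans (ltW xy) yb).
  by rewrite (le_trans ax (ltW xy)).
have [inc|dec] := itv_continuous_inj_mono fc finj.
  by exists false => x y ax xy yb; rewrite !mul1r inc ?(mem x y).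
by exists true => x y ax xy yb; rewrite !mulN1r ltrN2 dec ?(mem x y).
Qed.

End RealAux.

Section Developing.
Context {R : realType} {S : topologicalType} (F : bifoliation R S).

(** Y measures the transverse coordinate |dy| along the path g, and Y t - Y s is
    the length of g.  Charts agree up to sign and translation, so that only
    absolute values of increments make sense; they are taken from each c
    separately, which lets developments be glued. *)
Definition developing (g : R -> S) (s t : R) (Y : R -> R) :=
  (forall x y, s <= x -> x < y -> y <= t -> Y x < Y y) /\
  (forall c U phi, s <= c <= t -> charts F (U, phi) -> U (g c) ->
    \forall r \near c, s <= r <= t ->
      `|Y r - Y c| = `|(phi (g r)).2 - (phi (g c)).2|).

Lemma developing_sub g s t s' t' Y : s <= s' -> t' <= t ->
  developing g s t Y -> developing g s' t' Y.
Proof.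
move=> ss' tt' [inc isom]; split => [x y sx xy yt|c U phi /andP[sc ct] ch Ug].
  by apply: inc => //; [exact: le_trans sx|exact: le_trans tt'].
have : s <= c <= t by rewrite (le_trans ss')// (le_trans ct).
move=> /isom/(_ ch Ug); apply: filterS => r rst /andP[sr rt].
by apply: rst; rewrite (le_trans ss')// (le_trans rt).
Qed.

(** Two increasing functions whose increments agree in absolute value near each
    point have a locally constant difference. *)
Lemma developing_unique g s t Y Y' : s <= t ->
  (forall c, s <= c <= t -> ~ sing F (g c)) ->
  developing g s t Y -> developing g s t Y' -> Y t - Y s = Y' t - Y' s.
Proof.
move=> st nsing [inc isom] [inc' isom'].
suff : Y s - Y' s = Y t - Y' t by lra.
apply: (locally_constant (g := fun r => Y r - Y' r)) => // c cst.
have [U [phi [ch Ug]]] := chart_cover (nsing c cst).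
apply: filterS2 (isom c U phi cst ch Ug) (isom' c U phi cst ch Ug) => r rY rY' rst.
have : `|Y r - Y c| = `|Y' r - Y' c| by rewrite rY// rY'.
case/andP: cst rst => sc ct /andP[sr rt].
have [rc|cr|->//] := ltgtP r c.
  have := inc r c sr rc ct; have := inc' r c sr rc ct => ? ?.
  by rewrite !ltr0_norm; lra.
have := inc c r sc cr rt; have := inc' c r sc cr rt => ? ?.
by rewrite !gtr0_norm; lra.
Qed.

Lemma developing_glue g s t u Y Y' : s <= t -> t <= u ->
  developing g s t Y -> developing g t u Y' ->
  exists Y'', developing g s u Y''.
Proof.
move=> st tu [inc isom] [inc' isom'].
pose Z r := if r <= t then Y r else Y' r - Y' t + Y t.
have Zl r : r <= t -> Z r = Y r by rewrite /Z => ->.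
have Zr r : t <= r -> Z r = Y' r - Y' t + Y t.
  by rewrite /Z; case: ltgtP => // -> _; rewrite subrr add0r.
exists Z; split => [x y sx xy yu|c U phi /andP[sc cu] ch Ug].
  have [yt|ty] := leP y t.
    by rewrite !Zl ?(le_trans (ltW xy))//; exact: inc.
  have [xt|tx] := leP x t.
    rewrite (Zl x)// (Zr y) ?ltW//.
    have le1 : Y x <= Y t.
      by move: xt; rewrite le_eqVlt => /predU1P[->//|xt]; exact/ltW/inc.
    have := inc' t y (lexx _) ty yu; lra.
  by rewrite !Zr ?ltW// ltrD2r ltrD2r; apply: inc' => //; exact: ltW.
have near_l : c <= t -> \forall r \near c, s <= r <= t ->
    `|Z r - Z c| = `|(phi (g r)).2 - (phi (g c)).2|.
  move=> ct; have cst : s <= c <= t by rewrite sc.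
  apply: filterS (isom c U phi cst ch Ug) => r rY rst.
  by rewrite !Zl// ?rY//; case/andP: rst.
have near_r : t <= c -> \forall r \near c, t <= r <= u ->
    `|Z r - Z c| = `|(phi (g r)).2 - (phi (g c)).2|.
  move=> tc; have ctu : t <= c <= u by rewrite tc.
  apply: filterS (isom' c U phi ctu ch Ug) => r rY rtu.
  rewrite -rY// !Zr//; last by case/andP: rtu.
  by congr `|_|; lra.
have [ct|tc|ct] := ltgtP c t.
- have rt : \forall r \near c, r < t by exact: lt_nbhsl.
  apply: filterS2 (near_l (ltW ct)) rt => r rl rt /andP[sr _].
  by apply: rl; rewrite sr ltW.
- have tr : \forall r \near c, t < r by exact: lt_nbhsr.
  apply: filterS2 (near_r (ltW tc)) tr => r rr tr /andP[_ ru].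
  by apply: rr; rewrite ru ltW.
- have le_ct : c <= t by rewrite ct. have le_tc : t <= c by rewrite ct.
  apply: filterS2 (near_l le_ct) (near_r le_tc) => r rl rr /andP[sr ru].
  have [rt|tr] := leP r t; first by apply: rl; rewrite sr.
  by apply: rr; rewrite ru ltW.
Qed.

Lemma chart_transition_near (g : R -> S) (D : set R) (U V : set S) phi psi c :
  {within D, continuous g} -> D c -> charts F (U, phi) -> charts F (V, psi) ->
  U (g c) -> V (g c) -> \forall r \near c, D r ->
    `|(phi (g r)).2 - (phi (g c)).2| = `|(psi (g r)).2 - (psi (g c)).2|.
Proof.
move=> /subspace_continuousP gc Dc ch1 ch2 Uc Vc.
have [e [d near_gc]] := chart_transition ch1 ch2 Uc Vc.
have : \forall r \near c, D r -> (psi (g r)).2 - (psi (g c)).2 =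
    (-1) ^+ d * 1 * ((phi (g r)).2 - (phi (g c)).2).
  apply: (gc c Dc [set z | (psi z).2 - (psi (g c)).2 =
    (-1) ^+ d * 1 * ((phi z).2 - (phi (g c)).2)]).
  by apply: filterS near_gc => z [].
apply: filterS => r Dr rD; rewrite Dr// -mulrA mul1r normrMsign//.
Qed.

End Developing.

(** * Local geometry of a rectangle *)

Section Birectangle.
Context {R : realType} {S : topologicalType} (F : bifoliation R S).
Hypothesis hS : hausdorff_space S.
Variable rho : R * R -> S.
Hypothesis good : good_birectangle F rho.

Let rho_cont : {within unit_square, continuous rho}. Proof. by case: good. Qed.
Let rho_inj : {in unit_square &, injective rho}. Proof. by case: good. Qed.

Lemma square_inj z w : unit_square z -> unit_square w -> rho z = rho w -> z = w.
Proof. by move=> sz sw; apply: rho_inj; rewrite inE. Qed.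

Lemma horizontal_continuous (b s t : R) : 0 <= b <= 1 -> 0 <= s -> t <= 1 ->
  {within `[s, t], continuous (fun x => rho (x, b))}.
Proof.
move=> b01 s0 t1; apply: (within_comp (f := fun x => (x, b)) _ rho_cont).
  by apply/continuous_subspaceT/pair_continuous => x; [exact: cvg_id|exact: cvg_cst].
by move=> x /=; rewrite in_itv /= => /andP[sx xt]; split => //=; rewrite (le_trans s0)// (le_trans xt).
Qed.

Lemma vertical_continuous (a s t : R) : 0 <= a <= 1 -> 0 <= s -> t <= 1 ->
  {within `[s, t], continuous (fun y => rho (a, y))}.
Proof.
move=> a01 s0 t1; apply: (within_comp (f := fun y => (a, y)) _ rho_cont).
  by apply/continuous_subspaceT/pair_continuous => x; [exact: cvg_cst|exact: cvg_id].
by move=> x /=; rewrite in_itv /= => /andP[sx xt]; split => //=; rewrite (le_trans s0)// (le_trans xt).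
Qed.

(** The leaves of a chart are y = constant along horizontals and x = constant
    along verticals, so that x depends on s only and y on t only. *)
Lemma local_product (a b : R) U phi : unit_square (a, b) -> charts F (U, phi) ->
  U (rho (a, b)) -> exists2 d, 0 < d & forall s t, unit_square (s, t) ->
    `|s - a| < d -> `|t - b| < d -> [/\ U (rho (s, t)),
      (phi (rho (s, t))).1 = (phi (rho (s, b))).1 &
      (phi (rho (s, t))).2 = (phi (rho (a, t))).2].
Proof.
move=> sqab ch Uab; have [_ _ hor ver] := good.
have [[oU _ _ _] _] := chart_embedding ch.
have : \forall z \near (a, b), unit_square z -> U (rho z).
  have /subspace_continuousP/(_ _ sqab) rc := rho_cont.
  exact: (rc U (open_nbhs_nbhs (conj oU Uab))).
move=> /nbhs_ballP[d d0 near_ab]; exists d => // s t sqst sa tb.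
have {}near_ab x y : unit_square (x, y) -> `|x - a| < d -> `|y - b| < d -> U (rho (x, y)).
  by move=> sq xa yb; apply: near_ab => //; split; rewrite /ball /= distrC.
have [[/= s01 t01] [/= a01 b01]] := (sqst, sqab).
split; first exact: near_ab.
- have const x y : 0 <= x -> x <= y -> y <= 1 -> `|x - b| < d -> `|y - b| < d ->
     (phi (rho (s, x))).1 = (phi (rho (s, y))).1.
    move=> x0 xy y1 xb yb; apply: (locally_constant (g := fun r => (phi (rho (s, r))).1)) => //.
    move=> c /andP[xc cy].
    have c01 : 0 <= c <= 1 by rewrite (le_trans x0)// (le_trans cy).
    have cb : `|c - b| < d.
      by move: xb yb; rewrite !ltr_norml => /andP[? ?] /andP[? ?]; apply/andP; split; lra.
    have := (ver s s01).2 U phi c ch c01; move/(_ (near_ab _ _ (conj s01 c01) sa cb)).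
    apply: filterS => r rr /andP[xr ry]; apply: rr.
    by rewrite (le_trans x0)// (le_trans ry).
  case/andP: t01 => t0 t1; case/andP: b01 => b0 b1.
  have bb : `|b - b| < d by rewrite subrr normr0.
  by have [tb'|/ltW bt] := leP t b; [exact: const | apply/esym/const].
- have const x y : 0 <= x -> x <= y -> y <= 1 -> `|x - a| < d -> `|y - a| < d ->
     (phi (rho (x, t))).2 = (phi (rho (y, t))).2.
    move=> x0 xy y1 xa ya; apply: (locally_constant (g := fun r => (phi (rho (r, t))).2)) => //.
    move=> c /andP[xc cy].
    have c01 : 0 <= c <= 1 by rewrite (le_trans x0)// (le_trans cy).
    have ca : `|c - a| < d.
      by move: xa ya; rewrite !ltr_norml => /andP[? ?] /andP[? ?]; apply/andP; split; lra.
    have := (hor t t01).2 U phi c ch c01; move/(_ (near_ab _ _ (conj c01 t01) ca tb)).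
    apply: filterS => r rr /andP[xr ry]; apply: rr.
    by rewrite (le_trans x0)// (le_trans ry).
  case/andP: s01 => s0 s1; case/andP: a01 => a0 a1.
  have aa : `|a - a| < d by rewrite subrr normr0.
  by have [sa'|/ltW as'] := leP s a; [exact: const | apply/esym/const].
Qed.

Lemma chart_vertical_continuous (a s t : R) U phi : 0 <= a <= 1 -> 0 <= s -> t <= 1 ->
  charts F (U, phi) -> (forall y, s <= y <= t -> U (rho (a, y))) ->
  {within `[s, t], continuous (fun y => (phi (rho (a, y))).2)}.
Proof.
move=> a01 s0 t1 ch Usub; have [[oU _ phic _] _] := chart_embedding ch.
apply: (within_comp (f := fun y => phi (rho (a, y))) (E := setT) (g := snd)) => //; last first.
  by apply: continuous_subspaceT => z; exact: cvg_snd.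
apply: (within_comp (vertical_continuous a01 s0 t1) (E := U)); last first.
  by move=> y /=; rewrite in_itv /=; exact: Usub.
by apply: continuous_in_subspaceT.
Qed.

Lemma chart_horizontal_continuous (b s t : R) U phi : 0 <= b <= 1 -> 0 <= s -> t <= 1 ->
  charts F (U, phi) -> (forall x, s <= x <= t -> U (rho (x, b))) ->
  {within `[s, t], continuous (fun x => (phi (rho (x, b))).1)}.
Proof.
move=> b01 s0 t1 ch Usub; have [[oU _ phic _] _] := chart_embedding ch.
apply: (within_comp (f := fun x => phi (rho (x, b))) (E := setT) (g := fst)) => //; last first.
  by apply: continuous_subspaceT => z; exact: cvg_fst.
apply: (within_comp (horizontal_continuous b01 s0 t1) (E := U)); last first.
  by move=> y /=; rewrite in_itv /=; exact: Usub.
by apply: continuous_in_subspaceT.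
Qed.

(** The segment of radius d / 2 around b, clipped to [0, 1]: the ends of [0, 1]
    are then treated like the other points. *)
Lemma itv_around (b d : R) : 0 <= b <= 1 -> 0 < d -> exists s t : R,
  [/\ 0 <= s, s < t & t <= 1] /\ (forall r, s <= r <= t -> `|r - b| < d) /\
  (s <= b <= t) /\ (exists2 e, 0 < e & forall r, 0 <= r <= 1 -> `|r - b| < e -> s <= r <= t) /\
  (0 < b < 1 -> s < b < t).
Proof.
move=> /andP[b0 b1] d0; pose s := Num.max 0 (b - d / 2); pose t := Num.min 1 (b + d / 2).
have d20 : 0 < d / 2 by rewrite divr_gt0.
have s0 : 0 <= s by rewrite /s le_max lexx.
have sd : b - d / 2 <= s by rewrite /s le_max lexx orbT.
have t1 : t <= 1 by rewrite /t ge_min lexx.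
have td : t <= b + d / 2 by rewrite /t ge_min lexx orbT.
have sb : s <= b by rewrite /s ge_max b0 lerBlDr lerDl ltW.
have bt : b <= t by rewrite /t le_min b1 lerDl ltW.
exists s, t; split.
  split => //; rewrite /s /t gt_max !lt_min ltr01 /=.
  by apply/andP; split; [lra|apply/andP; split; lra].
split; first by move=> r /andP[sr rt]; rewrite ltr_norml; apply/andP; split; lra.
split; first by rewrite sb.
split.
  exists (d / 2) => // r /andP[r0 r1]; rewrite ltr_norml => /andP[? ?].
  by rewrite /s /t ge_max le_min r0 r1 /=; apply/andP; split; lra.
by move=> /andP[b0' b1']; rewrite /s /t gt_max lt_min b0' b1' /=; apply/andP; split; lra.
Qed.

(** The chart coordinate y of rho (a', t) depends on t only, so that one function
    develops all the verticals near a regular point. *)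
Lemma local_developing (a b : R) : unit_square (a, b) -> ~ sing F (rho (a, b)) ->
  exists d, exists Y : R -> R, 0 < d /\ forall s t, 0 <= s -> s <= t -> t <= 1 ->
    `|s - b| < d -> `|t - b| < d ->
    forall a', 0 <= a' <= 1 -> `|a' - a| < d -> developing F (fun y => rho (a', y)) s t Y.
Proof.
move=> sqab nsing; have [U [phi [ch Uab]]] := chart_cover nsing.
have [[_ inj_phi _ _] _] := chart_embedding ch.
have [d d0 prod] := local_product sqab ch Uab.
have [/= a01 b01] := sqab.
have [s0 [t0 [[s00 st0 t01] [near_b [_ [[e e0 near_e] _]]]]]] := itv_around b01 d0.
have aa : `|a - a| < d by rewrite subrr normr0.
have bb : `|b - b| < d by rewrite subrr normr0.
have itv01 y : s0 <= y <= t0 -> 0 <= y <= 1.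
  by move=> /andP[sy yt]; rewrite (le_trans s00)// (le_trans yt).
have Ya_cont : {within `[s0, t0], continuous (fun y => (phi (rho (a, y))).2)}.
  apply: (chart_vertical_continuous a01 s00 t01 ch) => y yst.
  by have [] := prod a y (conj a01 (itv01 y yst)) aa (near_b y yst).
have Ya_inj : {in `[s0, t0] &, injective (fun y => (phi (rho (a, y))).2)}.
  move=> y y'; rewrite !in_itv /= => yst y'st eq2.
  have [Uy y1 _] := prod a y (conj a01 (itv01 y yst)) aa (near_b y yst).
  have [Uy' y'1 _] := prod a y' (conj a01 (itv01 y' y'st)) aa (near_b y' y'st).
  have : phi (rho (a, y)) = phi (rho (a, y')).
    by rewrite [LHS]surjective_pairing [RHS]surjective_pairing eq2 y1 y'1.
  move/inj_phi; rewrite !inE => /(_ Uy Uy')/square_inj.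
  by move=> /(_ (conj a01 (itv01 y yst)) (conj a01 (itv01 y' y'st))) [].
have [sgn mono] := inj_strict_mono Ya_cont Ya_inj.
exists (Num.min d e), (fun y => (-1) ^+ sgn * (phi (rho (a, y))).2).
rewrite lt_min d0 e0; split => // s t s0' st t1; rewrite !lt_min => /andP[sd se] /andP[td te].
move=> a' a'01; rewrite lt_min => /andP[a'd _].
have s01 : 0 <= s <= 1 by rewrite s0' (le_trans st).
have t01' : 0 <= t <= 1 by rewrite t1 (le_trans s0').
have /andP[s0s st0'] := near_e s s01 se.
have /andP[s0t tt0] := near_e t t01' te.
split => [x y sx xy yt|c V psi /andP[sc ct] chV Vc].
  by apply: mono => //; [exact: le_trans sx|exact: le_trans tt0].
have cst0 : s0 <= c <= t0 by rewrite (le_trans s0s)// (le_trans ct).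
have [Uc _ c2] := prod a' c (conj a'01 (itv01 c cst0)) a'd (near_b c cst0).
have vc := vertical_continuous a'01 s0' t1.
have cD : `[s, t]%classic c by rewrite /= in_itv /= sc.
apply: filterS (chart_transition_near vc cD ch chV Uc Vc) => r rD /andP[sr rt].
have rst0 : s0 <= r <= t0 by rewrite (le_trans s0s)// (le_trans rt).
have [_ _ r2] := prod a' r (conj a'01 (itv01 r rst0)) a'd (near_b r rst0).
by rewrite -mulrBr normrMsign -r2 -c2 rD//= in_itv /= sr.
Qed.

Lemma developing_exists (a : R) : 0 <= a <= 1 ->
  (forall y, 0 <= y <= 1 -> ~ sing F (rho (a, y))) ->
  exists Y, developing F (fun y => rho (a, y)) 0 1 Y.
Proof.
move=> a01 nsing.
apply: (interval_induction (P := fun s t =>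
  exists Y, developing F (fun y => rho (a, y)) s t Y)) => //.
  move=> c c01; have [d [Y [d0 dev]]] := local_developing (conj a01 c01) (nsing c c01).
  exists d => // s t s0 st t1 sc tc; exists Y; apply: dev => //.
  by rewrite /= subrr normr0.
by move=> s t u _ st tu _ [Y devY] [Y' devY']; exact: developing_glue devY devY'.
Qed.

Definition coord_sing : set (R * R) := [set z | unit_square z /\ sing F (rho z)].

Lemma finite_coord_sing : finite_set coord_sing.
Proof.
apply: (@sub_finite_set _ _ (rect_coord rho @` sing F)).
  by move=> z [sqz sz]; exists (rho z) => //; exact: rect_coordK.
exact/finite_image/sing_finite.
Qed.

(** Verticals are disjoint and the singularities finitely many. *)
Lemma generic_vertical : exists2 a : R, 0 < a < 1 &
  forall y, 0 <= y <= 1 -> ~ sing F (rho (a, y)).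
Proof.
have fin : finite_set (fst @` coord_sing) by exact/finite_image/finite_coord_sing.
have [a a01 na] := avoid_finite fin ltr01.
exists a => // y y01 say; apply: na; exists (a, y) => //; split => //; split => //=.
by case/andP: a01 => ? ?; rewrite !ltW.
Qed.

Lemma generic_point (a s t : R) : 0 <= a <= 1 -> 0 <= s -> s < t -> t <= 1 ->
  exists2 b, s < b < t & ~ sing F (rho (a, b)).
Proof.
move=> a01 s0 st t1.
have fin : finite_set (snd @` coord_sing) by exact/finite_image/finite_coord_sing.
have [b /andP[sb bt] nb] := avoid_finite fin st.
exists b; first by rewrite sb.
move=> sab; apply: nb; exists (a, b) => //; split => //; split => //=.
by rewrite (le_trans s0 (ltW sb)) (le_trans (ltW bt)).
Qed.

(** Near each abscissa, a function common to the nearby verticals gives a positive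
    bound; compactness of [0, 1] makes it uniform. *)
Lemma vertical_length_ge : exists2 c, 0 < c & forall a Y, 0 <= a <= 1 ->
  (forall y, 0 <= y <= 1 -> ~ sing F (rho (a, y))) ->
  developing F (fun y => rho (a, y)) 0 1 Y -> c <= Y 1 - Y 0.
Proof.
suff [c c0 cP] : exists2 c, 0 < c & forall a Y, 0 <= a <= 1 -> 0 <= a <= 1 ->
  (forall y, 0 <= y <= 1 -> ~ sing F (rho (a, y))) ->
  developing F (fun y => rho (a, y)) 0 1 Y -> c <= Y 1 - Y 0.
  by exists c => // a Y a01; exact: cP.
apply: (interval_induction (P := fun s t => exists2 c, 0 < c & forall a Y, s <= a <= t ->
  0 <= a <= 1 -> (forall y, 0 <= y <= 1 -> ~ sing F (rho (a, y))) ->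
  developing F (fun y => rho (a, y)) 0 1 Y -> c <= Y 1 - Y 0)) => //; last first.
  move=> s t u _ st tu _ [c c0 cP] [c' c'0 c'P].
  exists (Num.min c c'); first by rewrite lt_min c0.
  move=> a Y /andP[sa au] a01 nsing dev; rewrite ge_min.
  have [at_|/ltW ta] := leP a t; first by rewrite (cP a) ?sa.
  by rewrite (c'P a) ?ta ?orbT.
move=> a a01; have [b b01 nsing] := generic_point a01 (lexx 0) ltr01 (lexx 1).
have {}b01 : 0 <= b <= 1 by case/andP: b01 => ? ?; rewrite !ltW.
have [d [Z [d0 devZ]]] := local_developing (conj a01 b01) nsing.
have [s [t [[s0 st t1] [near_b _]]]] := itv_around b01 d0.
have sb : `|s - b| < d by apply: near_b; rewrite lexx ltW.
have tb : `|t - b| < d by apply: near_b; rewrite lexx ltW.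
exists d => // u v _ uv _ ua va; exists (Z t - Z s).
  have aa : `|a - a| < d by rewrite subrr normr0.
  by rewrite subr_gt0; apply: (devZ s t s0 (ltW st) t1 sb tb a a01 aa).1.
move=> a' Y /andP[ua' a'v] a'01 ns dev.
have a'a : `|a' - a| < d.
  by move: ua va; rewrite !ltr_norml => /andP[? ?] /andP[? ?]; apply/andP; split; lra.
have devZ' := devZ s t s0 (ltW st) t1 sb tb a' a'01 a'a.
have nst c : s <= c <= t -> ~ sing F (rho (a', c)).
  by move=> /andP[sc ct]; apply: ns; rewrite (le_trans s0)// (le_trans ct).
rewrite -(developing_unique (ltW st) nst (developing_sub s0 t1 dev) devZ').
have [inc _] := dev.
have ss : Y 0 <= Y s.
  move: s0; rewrite le_eqVlt => /predU1P[<-//|s0]; apply/ltW/inc => //.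
  exact: le_trans (ltW st) t1.
have tt : Y t <= Y 1.
  move: t1; rewrite le_eqVlt => /predU1P[->//|t1]; apply/ltW/inc => //.
  exact: le_trans s0 (ltW st).
lra.
Qed.

(** In a chart, the rectangle is locally the product of two intervals, by the
    intermediate value theorem, and the point is interior to both. *)
Lemma rect_interior (a b : R) : 0 < a < 1 -> 0 < b < 1 -> ~ sing F (rho (a, b)) ->
  (rect rho)° (rho (a, b)).
Proof.
move=> a01' b01' nsing.
have a01 : 0 <= a <= 1 by case/andP: a01' => ? ?; rewrite !ltW.
have b01 : 0 <= b <= 1 by case/andP: b01' => ? ?; rewrite !ltW.
have [U [phi [ch Uab]]] := chart_cover nsing.
have [[oU inj_phi phi_cont _] _] := chart_embedding ch.
have sqab : unit_square (a, b) by [].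
have [d d0 prod] := local_product sqab ch Uab.
have [s [t [[s0 st t1] [near_b [_ [_ /(_ b01') /andP[sb bt]]]]]]] := itv_around b01 d0.
have [u [v [[u0 uv v1] [near_a [_ [_ /(_ a01') /andP[ua av]]]]]]] := itv_around a01 d0.
have aa : `|a - a| < d by rewrite subrr normr0.
have bb : `|b - b| < d by rewrite subrr normr0.
have itvb y : s <= y <= t -> 0 <= y <= 1.
  by move=> /andP[sy yt]; rewrite (le_trans s0)// (le_trans yt).
have itva x : u <= x <= v -> 0 <= x <= 1.
  by move=> /andP[ux xv]; rewrite (le_trans u0)// (le_trans xv).
pose X x := (phi (rho (x, b))).1; pose Y y := (phi (rho (a, y))).2.
have P x y : u <= x <= v -> s <= y <= t -> U (rho (x, y)) /\ phi (rho (x, y)) = (X x, Y y).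
  move=> xuv yst; have [Uxy x1 y2] := prod x y (conj (itva x xuv) (itvb y yst)) (near_a x xuv) (near_b y yst).
  by split => //; rewrite [LHS]surjective_pairing x1 y2.
have ast : u <= a <= v by rewrite !ltW.
have bst : s <= b <= t by rewrite !ltW.
have Xc : {within `[u, v], continuous X}.
  by apply: (chart_horizontal_continuous b01 u0 v1 ch) => x xuv; have [] := P x b xuv bst.
have Yc : {within `[s, t], continuous Y}.
  by apply: (chart_vertical_continuous a01 s0 t1 ch) => y yst; have [] := P a y ast yst.
have Xinj : {in `[u, v] &, injective X}.
  move=> x x'; rewrite !in_itv /= => xuv x'uv eqX.
  have [Ux px] := P x b xuv bst; have [Ux' px'] := P x' b x'uv bst.
  have : rho (x, b) = rho (x', b) by apply: inj_phi; rewrite ?inE// px px' eqX.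
  by move=> /(@square_inj (x, b) (x', b) (conj (itva x xuv) b01) (conj (itva x' x'uv) b01)) [].
have Yinj : {in `[s, t] &, injective Y}.
  move=> y y'; rewrite !in_itv /= => yst y'st eqY.
  have [Uy py] := P a y ast yst; have [Uy' py'] := P a y' ast y'st.
  have : rho (a, y) = rho (a, y') by apply: inj_phi; rewrite ?inE// py py' eqY.
  by move=> /(@square_inj (a, y) (a, y') (conj a01 (itvb y yst)) (conj a01 (itvb y' y'st))) [].
have between (f : R -> R) (l m r : R) : {within `[l, r], continuous f} ->
    {in `[l, r] &, injective f} -> l < m -> m < r ->
    Num.min (f l) (f r) < f m < Num.max (f l) (f r).
  move=> fc fi lm mr; have [e mono] := inj_strict_mono fc fi.
  have := mono l m (lexx _) lm (ltW mr); have := mono m r (ltW lm) mr (lexx _).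
  rewrite gt_min lt_max; case: e {mono} => /=; rewrite ?mulN1r ?mul1r ?ltrN2 => ? ?.
    by apply/andP; split; apply/orP; [right|left].
  by apply/andP; split; apply/orP; [left|right].
have /andP[Xl Xr] := between X u a v Xc Xinj ua av.
have /andP[Yl Yr] := between Y s b t Yc Yinj sb bt.
have [_ pab] := P a b ast bst.
have phic : {for rho (a, b), continuous phi} by apply: phi_cont; rewrite inE.
have c1 : {for rho (a, b), continuous (fst \o phi)}.
  exact: (@continuous_comp _ _ _ phi fst _ phic cvg_fst).
have c2 : {for rho (a, b), continuous (snd \o phi)}.
  exact: (@continuous_comp _ _ _ phi snd _ phic cvg_snd).
have nU : \forall z \near rho (a, b), U z by exact: open_nbhs_nbhs.
have n1 : \forall z \near rho (a, b), Num.min (X u) (X v) < (phi z).1 < Num.max (X u) (X v).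
  apply: (c1 [set x | Num.min (X u) (X v) < x < Num.max (X u) (X v)]); rewrite /= pab /=.
  by near=> x; apply/andP; split; near: x; [exact: lt_nbhsr|exact: lt_nbhsl].
have n2 : \forall z \near rho (a, b), Num.min (Y s) (Y t) < (phi z).2 < Num.max (Y s) (Y t).
  apply: (c2 [set x | Num.min (Y s) (Y t) < x < Num.max (Y s) (Y t)]); rewrite /= pab /=.
  by near=> x; apply/andP; split; near: x; [exact: lt_nbhsr|exact: lt_nbhsl].
rewrite /interior; near=> z.
have Uz : U z by near: z.
have /andP[z1l z1r] : Num.min (X u) (X v) < (phi z).1 < Num.max (X u) (X v) by near: z.
have /andP[z2l z2r] : Num.min (Y s) (Y t) < (phi z).2 < Num.max (Y s) (Y t) by near: z.
have [|x] := IVT (v := (phi z).1) (ltW uv) Xc; first by rewrite !ltW.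
rewrite in_itv /= => xuv Xx.
have [|y] := IVT (v := (phi z).2) (ltW st) Yc; first by rewrite !ltW.
rewrite in_itv /= => yst Yy.
have [Uxy pxy] := P x y xuv yst.
exists (x, y); first by split; [exact: itva|exact: itvb].
by apply: inj_phi; rewrite ?inE// pxy Xx Yy -surjective_pairing.
Unshelve. all: by end_near. Qed.

End Birectangle.

(** * Crossings of a Markov partition *)

(** Additivity of the Lebesgue measure on disjoint open intervals. *)
Lemma sum_disjoint_le (R : realType) (J : finType) (P : pred J) (p q : J -> R) (a b : R) :
  a <= b -> (forall j, P j -> [/\ a <= p j, p j <= q j & q j <= b]) ->
  (forall j k, P j -> P k -> j != k -> q j <= p k \/ q k <= p j) ->
  \sum_(j | P j) (q j - p j) <= b - a.
Proof.
move=> ab pq disj; rewrite -lee_fin -sumEFin.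
have itv x y : x <= y -> lebesgue_measure `]x, y[%classic = (y - x)%:E :> \bar R.
  by move=> xy; rewrite lebesgue_measure_itv /= lte_fin; case: ltgtP xy => // ->; rewrite subrr.
have -> : (\sum_(j | P j) (q j - p j)%:E =
    lebesgue_measure (\bigcup_(j in [set j | P j]) `]p j, q j[%classic))%E.
  rewrite measure_fin_bigcup//.
  - rewrite (bigfs _ (index_enum_uniq J)); last by move=> j _; rewrite mem_index_enum.
    apply: eq_fsbigr => j; rewrite inE /= => Pj.
    by have [_ ? _] := pq j Pj; rewrite itv.
  - exact: finite_finset.
  - move=> j k /= Pj Pk [x [/=]]; rewrite !in_itv /= => /andP[pj qj] /andP[pk qk].
    by apply: contrapT => /eqP jk; case: (disj j k Pj Pk jk) => ?; lra.
have -> : (b - a)%:E = lebesgue_measure `[a, b]%classic :> \bar R.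
  by rewrite lebesgue_measure_itv /= lte_fin; case: ltgtP ab => // ->; rewrite subrr.
apply: le_measure; rewrite ?inE.
- by apply: fin_bigcup_measurable => // j _; exact: measurable_itv.
- exact: measurable_itv.
- move=> x [j /= Pj]; rewrite !in_itv /= => /andP[? ?].
  by have [? ? ?] := pq j Pj; apply/andP; split; lra.
Qed.

Section Markov.
Context {R : realType} {S : topologicalType} (F : bifoliation R S).
Variables (f : homeo S S) (lambda : R) (m : nat) (rho : 'I_m -> R * R -> S).
Hypotheses (hS : hausdorff_space S) (pA : pseudo_anosov F lambda f)
  (markov : markov_partition F f rho).

Let good i : good_birectangle F (rho i). Proof. by case: markov. Qed.
Let rho_cont i : {within unit_square, continuous (rho i)}. Proof. by case: (good i). Qed.
Let rho_inj i z w : unit_square z -> unit_square w -> rho i z = rho i w -> z = w.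
Proof. exact: (square_inj (good i)). Qed.
Let lambda_gt0 : 0 < lambda. Proof. by case: pA => l1 _ _; exact: lt_trans l1. Qed.

Definition transition (i j : 'I_m) : Prop :=
  exists x, (rect (rho i))° x /\ (rect (rho j))° (f x).

Lemma stable_segP i a b y : unit_square (a, b) ->
  stable_seg (rho i) (rho i (a, b)) y <-> exists2 s, 0 <= s <= 1 & y = rho i (s, b).
Proof.
move=> sqab; split => [[a' [b' [s [sqab' s01 e ->]]]]|[s s01 ->]]; last by exists a, b, s.
by have [_ ->] := rho_inj sqab sqab' e; exists s.
Qed.

Lemma unstable_segP i a b y : unit_square (a, b) ->
  unstable_seg (rho i) (rho i (a, b)) y <-> exists2 s, 0 <= s <= 1 & y = rho i (a, s).
Proof.
move=> sqab; split => [[a' [b' [s [sqab' s01 e ->]]]]|[s s01 ->]]; last by exists a, b, s.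
by have [-> _] := rho_inj sqab sqab' e; exists s.
Qed.

Lemma stable_image i j x a b a' b' s : (rect (rho i))° x -> (rect (rho j))° (f x) ->
  x = rho i (a, b) -> f x = rho j (a', b') -> unit_square (a, b) -> unit_square (a', b') ->
  0 <= s <= 1 -> exists2 s', 0 <= s' <= 1 & f (rho i (s, b)) = rho j (s', b').
Proof.
move=> xi fxj ex efx sq sq' s01; have [_ _ _ mk] := markov.
have [/(_ (f (rho i (s, b)))) st _ _ _] := mk i j x xi fxj.
rewrite efx in st; apply/(stable_segP _ _ sq')/st.
by exists (rho i (s, b)) => //; rewrite ex; apply/(stable_segP _ _ sq); exists s.
Qed.

Lemma unstable_image i j x a b a' b' s : (rect (rho i))° x -> (rect (rho j))° (f x) ->
  x = rho i (a, b) -> f x = rho j (a', b') -> unit_square (a, b) -> unit_square (a', b') ->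
  0 <= s <= 1 -> rect (rho j) (f (rho i (a, s))) ->
  exists2 s', 0 <= s' <= 1 & f (rho i (a, s)) = rho j (a', s').
Proof.
move=> xi fxj ex efx sq sq' s01 Rj; have [_ _ _ mk] := markov.
have [_ _ un _] := mk i j x xi fxj.
rewrite efx in un; apply/(unstable_segP _ _ sq'); rewrite -un; split => //.
by exists (rho i (a, s)) => //; rewrite ex; apply/(unstable_segP _ _ sq); exists s.
Qed.

Lemma unstable_preimage i j x a b a' b' s : (rect (rho i))° x -> (rect (rho j))° (f x) ->
  x = rho i (a, b) -> f x = rho j (a', b') -> unit_square (a, b) -> unit_square (a', b') ->
  0 <= s <= 1 -> exists2 s', 0 <= s' <= 1 & f (rho i (a, s')) = rho j (a', s).
Proof.
move=> xi fxj ex efx sq sq' s01; have [_ _ _ mk] := markov.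
have [_ _ un _] := mk i j x xi fxj.
have : unstable_seg (rho j) (f x) (rho j (a', s)).
  by rewrite efx; apply/(unstable_segP _ _ sq'); exists s.
rewrite -un => -[[y + fy] _]; rewrite ex => /(unstable_segP _ _ sq)[s' s'01 ys].
by exists s' => //; rewrite -ys.
Qed.

(** The set of all possible x is open, so that (a, b) can vary in a small square
    of the open unit square.  Along a vertical of this small square the image
    runs injectively along a vertical of R_j; among three points of it, one has
    an image whose ordinate b' is neither 0 nor 1. *)
Lemma transition_interior i j : transition i j -> exists a b a' b',
  [/\ 0 < a < 1, 0 < b < 1, unit_square (a', b') & 0 < b' < 1] /\
  [/\ (rect (rho i))° (rho i (a, b)), (rect (rho j))° (f (rho i (a, b))) &
      f (rho i (a, b)) = rho j (a', b')].
Proof.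
move=> [x [xi fxj]].
have [[a0 b0] sq0 x0] := interior_subset xi; rewrite -x0 in xi fxj.
have near0 : \forall z \near (a0, b0), unit_square z ->
    (rect (rho i))° (rho i z) /\ (rect (rho j))° (f (rho i z)).
  have /subspace_continuousP/(_ _ sq0) rc := @rho_cont i.
  apply: (rc [set y | (rect (rho i))° y /\ (rect (rho j))° (f y)]).
  apply: filterI; first exact: (open_nbhs_nbhs (conj (@open_interior _ _) xi)).
  apply: (homeo_fun_cont (h := f)).
  exact: (open_nbhs_nbhs (conj (@open_interior _ _) fxj)).
have [d /= d0 {}near0] := (nbhs_ballP _ _).1 near0.
have [/= a01 b01] := sq0.
have [s [t [[s0 st t1] [near_b _]]]] := itv_around b01 d0.
have [u [v [[u0 uv v1] [near_a _]]]] := itv_around a01 d0.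
pose a := (u + v) / 2.
have ua : u < a < v by rewrite /a; apply/andP; split; lra.
have aa : 0 < a < 1 by case/andP: ua => ? ?; apply/andP; split; lra.
have P b : s < b < t -> [/\ 0 < b < 1, unit_square (a, b), (rect (rho i))° (rho i (a, b)) &
    (rect (rho j))° (f (rho i (a, b)))].
  move=> /andP[sb bt]; have bb : 0 < b < 1 by apply/andP; split; lra.
  have sqab : unit_square (a, b).
    by case/andP: aa => ? ?; case/andP: bb => ? ?; split; rewrite /= !ltW.
  have [|? ?] := near0 (a, b) _ sqab; last by split.
  split; rewrite /ball /= distrC; [apply: near_a|apply: near_b]; rewrite ?(ltW sb) ?(ltW bt)//.
  by case/andP: ua => ? ?; rewrite !ltW.
pose b1 := s + (t - s) / 4; pose b2 := s + (t - s) / 2; pose b3 := s + (t - s) * (3 / 4).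
have [b1P b2P b3P] : [/\ s < b1 < t, s < b2 < t & s < b3 < t].
  by rewrite /b1 /b2 /b3; split; apply/andP; split; lra.
have [b12 b13 b23] : [/\ b1 != b2, b1 != b3 & b2 != b3].
  by rewrite /b1 /b2 /b3; split; rewrite lt_eqF//; lra.
have [_ sq1 i1 j1] := P b1 b1P.
have [[a' b'] sq' e'] := interior_subset j1.
have Q b : s < b < t -> exists2 s', 0 <= s' <= 1 & f (rho i (a, b)) = rho j (a', s').
  move=> bP; have [bb sqb ib jb] := P b bP.
  apply: (unstable_image i1 j1 erefl (esym e') sq1 sq'); first by case: sqb.
  exact: interior_subset.
have uniq b c s' : s < b < t -> s < c < t -> f (rho i (a, b)) = rho j (a', s') ->
    f (rho i (a, c)) = rho j (a', s') -> b = c.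
  move=> bP cP eb ec; have [_ sqb _ _] := P b bP; have [_ sqc _ _] := P c cP.
  have : rho i (a, b) = rho i (a, c) by apply: (@homeo_inj _ _ f); rewrite eb ec.
  by move/(rho_inj sqb sqc) => [].
have found b s' : s < b < t -> 0 < s' < 1 -> f (rho i (a, b)) = rho j (a', s') ->
  exists a b a' b', [/\ 0 < a < 1, 0 < b < 1, unit_square (a', b') & 0 < b' < 1] /\
  [/\ (rect (rho i))° (rho i (a, b)), (rect (rho j))° (f (rho i (a, b))) &
      f (rho i (a, b)) = rho j (a', b')].
  move=> bP s'01 e; have [bb sqb ib jb] := P b bP.
  exists a, b, a', s'; split; split => //; split => //=; first by case: sq'.
  by case/andP: s'01 => ? ?; rewrite !ltW.
have [s1 s1P e1] := Q b1 b1P; have [s2 s2P e2] := Q b2 b2P; have [s3 s3P e3] := Q b3 b3P.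
have ends (r : R) : 0 <= r <= 1 -> [\/ 0 < r < 1, r = 0 | r = 1].
  move=> /andP[]; rewrite le_eqVlt => /predU1P[<- _|r0]; first by constructor 2.
  rewrite le_eqVlt => /predU1P[->|r1]; first by constructor 3.
  by constructor 1; rewrite r0.
have [|z1|z1] := ends s1 s1P; first by move=> ?; exact: (found b1 s1).
- have [|z2|z2] := ends s2 s2P; first by move=> ?; exact: (found b2 s2).
    by case/eqP: b12; apply: (uniq _ _ s1) => //; rewrite z1 -z2.
  have [|z3|z3] := ends s3 s3P; first by move=> ?; exact: (found b3 s3).
    by case/eqP: b13; apply: (uniq _ _ s1) => //; rewrite z1 -z3.
  by case/eqP: b23; apply: (uniq _ _ s2) => //; rewrite z2 -z3.
- have [|z2|z2] := ends s2 s2P; first by move=> ?; exact: (found b2 s2).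
    have [|z3|z3] := ends s3 s3P; first by move=> ?; exact: (found b3 s3).
      by case/eqP: b23; apply: (uniq _ _ s2) => //; rewrite z2 -z3.
    by case/eqP: b13; apply: (uniq _ _ s1) => //; rewrite z1 -z3.
  by case/eqP: b12; apply: (uniq _ _ s1) => //; rewrite z1 -z2.
Qed.

(** Lengths are measured along these verticals only: they consist of interior
    points of the rectangle, except for their two ends. *)
Definition regular_vertical i (a : R) :=
  0 < a < 1 /\ forall y, 0 <= y <= 1 -> ~ sing F (rho i (a, y)).

(** Let y be the point given by [transition_interior].  Its horizontal is mapped
    in a horizontal of R_j, injectively, so monotonically; as a is not an end of
    [0, 1], neither is the abscissa a' of the image of the point of abscissa a.
    This point and its image are thus interior, and the Markov property applies
    at this point. *)
Lemma vertical_crossing i j a : regular_vertical i a -> transition i j ->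
  exists a' (tau : R -> R), regular_vertical j a' /\
  forall t, 0 <= t <= 1 -> 0 <= tau t <= 1 /\ rho j (a', t) = f (rho i (a, tau t)).
Proof.
move=> [a01 reg] /transition_interior[c [b [c' [b' [[c01 b01 sqc' b'01] [ci cj ec]]]]]].
have wk (r : R) : 0 < r < 1 -> 0 <= r <= 1 by move=> /andP[? ?]; rewrite !ltW.
have sqc : unit_square (c, b) by split; apply: wk.
have ex_A s : exists s', 0 <= s <= 1 -> 0 <= s' <= 1 /\ f (rho i (s, b)) = rho j (s', b').
  have [s01|ns] := pselect (0 <= s <= 1); last by exists 0.
  have [s' s'01 e] := stable_image ci cj erefl ec sqc sqc' s01.
  by exists s'.
have [A AP] := choice ex_A.
have A_cont : {within `[0, 1], continuous A}.
  apply: (@compact_factor R S R `[0, 1]%classic (fun s => rho j (s, b')) `[0, 1]%classic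
    (fun s => f (rho i (s, b))) A hS).
  - exact: segment_compact.
  - by apply: (horizontal_continuous (good j)) => //; exact: wk.
  - move=> s t; rewrite !inE /= !in_itv /= => s01 t01.
    have sqs : unit_square (s, b') by split => //=; exact: wk.
    have sqt : unit_square (t, b') by split => //=; exact: wk.
    by move/(rho_inj sqs sqt) => [].
  - apply: (within_comp (E := setT) (g := f)) => //; last first.
      exact/continuous_subspaceT/homeo_fun_cont.
    by apply: (horizontal_continuous (good i)) => //; exact: wk.
  - by move=> s /=; rewrite in_itv /= => /AP[? ?]; rewrite in_itv.
have A_inj : {in `[0, 1] &, injective A}.
  move=> s t; rewrite !in_itv /= => s01 t01 eA.
  have [_ es] := AP s s01; have [_ et] := AP t t01.
  have sqs : unit_square (s, b) by split => //=; exact: wk.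
  have sqt : unit_square (t, b) by split => //=; exact: wk.
  have : rho i (s, b) = rho i (t, b) by apply: (@homeo_inj _ _ f); rewrite es et eA.
  by move/(rho_inj sqs sqt) => [].
have Aa : 0 < A a < 1.
  have [e mono] := inj_strict_mono A_cont A_inj.
  case/andP: a01 => a0 a1.
  have := mono 0 a (lexx _) a0 (ltW a1); have := mono a 1 (ltW a0) a1 (lexx _).
  have [/andP[? ?] _] : 0 <= A 0 <= 1 /\ f (rho i (0, b)) = rho j (A 0, b').
    by apply: AP; rewrite lexx ler01.
  have [/andP[? ?] _] : 0 <= A 1 <= 1 /\ f (rho i (1, b)) = rho j (A 1, b').
    by apply: AP; rewrite lexx ler01.
  by case: e {mono} => /=; rewrite ?mulN1r ?mul1r => ? ?; apply/andP; split; lra.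
have [_ ea] := AP a (wk _ a01).
have sqa : unit_square (a, b) by split; apply: wk.
have sqA : unit_square (A a, b') by split; apply: wk.
have regz : ~ sing F (rho i (a, b)) by apply: reg; apply: wk.
have [_ sing_f _] := pA.
have zi : (rect (rho i))° (rho i (a, b)) by apply: (rect_interior (good i)).
have zj : (rect (rho j))° (f (rho i (a, b))).
  by rewrite ea; apply: (rect_interior (good j)) => //; rewrite -ea => /sing_f.
have ex_tau t : exists s, 0 <= t <= 1 -> 0 <= s <= 1 /\ rho j (A a, t) = f (rho i (a, s)).
  have [t01|nt] := pselect (0 <= t <= 1); last by exists 0.
  have [s s01 e] := unstable_preimage zi zj erefl ea sqa sqA t01.
  by exists s.
have [tau tauP] := choice ex_tau.
exists (A a), tau; split => //; split => // y y01.
by have [t01 ->] := tauP y y01; move/sing_f; exact: reg.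
Qed.

Section Crossing.
Variables (i j : 'I_m) (a a' : R) (tau : R -> R).
Hypotheses (reg : regular_vertical i a) (reg' : regular_vertical j a').
Hypothesis tauP : forall t, 0 <= t <= 1 ->
  0 <= tau t <= 1 /\ rho j (a', t) = f (rho i (a, tau t)).

Let a01 : 0 <= a <= 1. Proof. by case: reg => /andP[? ?]; rewrite !ltW. Qed.
Let a'01 : 0 <= a' <= 1. Proof. by case: reg' => /andP[? ?]; rewrite !ltW. Qed.

Lemma tau_continuous : {within `[0, 1], continuous tau}.
Proof.
apply: (@compact_factor R S R `[0, 1]%classic (fun s => f (rho i (a, s))) `[0, 1]%classic
    (fun s => rho j (a', s)) tau hS).
- exact: segment_compact.
- apply: (within_comp (E := setT) (g := f)) => //; last first.
    exact/continuous_subspaceT/homeo_fun_cont.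
  exact: (vertical_continuous (good i)).
- move=> s t; rewrite !inE /= !in_itv /= => s01 t01 /homeo_inj.
  by move/(@rho_inj i (a, s) (a, t) (conj a01 s01) (conj a01 t01)) => [].
- exact: (vertical_continuous (good j)).
- by move=> s /=; rewrite in_itv /= => /tauP[? ?]; rewrite in_itv.
Qed.

Lemma tau_inj : {in `[0, 1] &, injective tau}.
Proof.
move=> s t; rewrite !in_itv /= => s01 t01 e.
have [_ es] := tauP s01; have [_ et] := tauP t01.
have : rho j (a', s) = rho j (a', t) by rewrite es et e.
by move/(@rho_inj j (a', s) (a', t) (conj a'01 s01) (conj a'01 t01)) => [].
Qed.

(** f multiplies the transverse coordinate by lambda; the sign is there because
    tau may be decreasing. *)
Lemma developing_image Y : developing F (fun y => rho i (a, y)) 0 1 Y ->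
  exists e : bool, developing F (fun y => rho j (a', y)) 0 1
    (fun t => (-1) ^+ e * (lambda * Y (tau t))).
Proof.
move=> [inc isom]; have [e mono] := inj_strict_mono tau_continuous tau_inj.
exists e; split => [x y x0 xy y1|c U psi c01 ch Uc].
  have [/andP[tx0 tx1] _] : 0 <= tau x <= 1 /\ rho j (a', x) = f (rho i (a, tau x)).
    by apply: tauP; rewrite x0 (le_trans (ltW xy)).
  have [/andP[ty0 ty1] _] : 0 <= tau y <= 1 /\ rho j (a', y) = f (rho i (a, tau y)).
    by apply: tauP; rewrite y1 (le_trans x0 (ltW xy)).
  have := mono x y x0 xy y1.
  case: e {mono} => /=; rewrite ?mulN1r ?mul1r ?ltrN2 ltr_pM2l// => ?; exact: inc.
have [tc01 ec] := tauP c01.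
have [V [phi [chV Vc]]] := chart_cover (reg.2 (tau c) tc01).
have [_ _ /(_ V phi U psi (rho i (a, tau c)) chV ch Vc)] := pA.
rewrite -ec => /(_ Uc)[e1 [e2 near_p]].
have /subspace_continuousP tau_c := tau_continuous.
have cD : `[0, 1]%classic c by rewrite /= in_itv.
have n1 : \forall r \near c, 0 <= r <= 1 ->
    `|Y (tau r) - Y (tau c)| = `|(phi (rho i (a, tau r))).2 - (phi (rho i (a, tau c))).2|.
  have := tau_c c cD _ (isom (tau c) V phi tc01 chV Vc).
  rewrite /within/= => n; suff : \forall r \near c, `[0, 1]%classic r ->
     0 <= tau r <= 1 -> `|Y (tau r) - Y (tau c)| = `|(phi (rho i (a, tau r))).2 - (phi (rho i (a, tau c))).2|.
    apply: filterS => r rP r01; apply: rP; first by rewrite /= in_itv.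
    by have [] := tauP r01.
  exact: n.
have n2 : \forall r \near c, 0 <= r <= 1 ->
    (psi (f (rho i (a, tau r)))).2 - (psi (rho j (a', c))).2 =
    (-1) ^+ e2 * lambda * ((phi (rho i (a, tau r))).2 - (phi (rho i (a, tau c))).2).
  have vc : {within `[0, 1], continuous (fun t => rho i (a, tau t))}.
    apply: (@within_comp R R S `[0, 1]%classic `[0, 1]%classic tau (fun y => rho i (a, y))).
    - exact: tau_continuous.
      exact: (vertical_continuous (good i)).
    by move=> r /=; rewrite !in_itv /= => /tauP[].
  have /subspace_continuousP/(_ c cD) vcc := vc.
  have := vcc [set z | (psi (f z)).2 - (psi (rho j (a', c))).2 =
    (-1) ^+ e2 * lambda * ((phi z).2 - (phi (rho i (a, tau c))).2)].
  move=> n; suff : \forall r \near c, `[0, 1]%classic r ->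
     (psi (f (rho i (a, tau r)))).2 - (psi (rho j (a', c))).2 =
    (-1) ^+ e2 * lambda * ((phi (rho i (a, tau r))).2 - (phi (rho i (a, tau c))).2).
    by apply: filterS => r rP r01; apply: rP; rewrite /= in_itv.
  apply: n; rewrite ec in near_p *.
  by apply: filterS near_p => z [].
apply: filterS2 n1 n2 => r n1 n2 r01.
have [_ er] := tauP r01.
rewrite -mulrBr normrMsign -mulrBr normrM n1// er n2//.
by rewrite -mulrA normrMsign normrM.
Qed.

Lemma tau_itv x : Num.min (tau 0) (tau 1) < x < Num.max (tau 0) (tau 1) ->
  exists2 t, 0 < t < 1 & tau t = x.
Proof.
move=> /andP[lx xu].
have [|t] := IVT (v := x) (@ler01 R) tau_continuous; first by rewrite !ltW.
rewrite in_itv /= => /andP[t0 t1] tx; exists t => //.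
apply/andP; split; rewrite lt_neqAle ?t0 ?t1 andbT; apply/eqP => e.
  by move: lx xu; rewrite -tx -e gt_min lt_max !ltxx /= => ? ?; lra.
by move: lx xu; rewrite -tx e gt_min lt_max !ltxx !orbF => ? ?; lra.
Qed.

End Crossing.

End Markov.

(** * Heights of rectangles *)

Section Heights.
Context {R : realType} {S : topologicalType} (F : bifoliation R S).
Variables (f : homeo S S) (lambda : R) (m : nat) (rho : 'I_m -> R * R -> S).
Hypotheses (hS : hausdorff_space S) (pA : pseudo_anosov F lambda f)
  (markov : markov_partition F f rho).

Let good i : good_birectangle F (rho i). Proof. by case: markov. Qed.
Let rho_cont i : {within unit_square, continuous (rho i)}. Proof. by case: (good i). Qed.
Let lambda_gt0 : 0 < lambda. Proof. by case: pA => l1 _ _; exact: lt_trans l1. Qed.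

(** A common point would be interior to R_i and a limit of interior points
    of R_j. *)
Lemma verticals_disjoint i j a b s t : i != j ->
  regular_vertical F rho i a -> regular_vertical F rho j b ->
  0 < s < 1 -> 0 <= t <= 1 -> rho i (a, s) <> rho j (b, t).
Proof.
move=> ij [a01 rega] [b01 regb] s01 t01 e.
have wk (r : R) : 0 < r < 1 -> 0 <= r <= 1 by move=> /andP[? ?]; rewrite !ltW.
have si : (rect (rho i))° (rho i (a, s)).
  by apply: (rect_interior (good i)) => //; apply: rega; exact: wk.
have sqbt : unit_square (b, t) by split => //=; exact: wk.
have : \forall z \near (b, t), unit_square z -> (rect (rho i))° (rho j z).
  have /subspace_continuousP/(_ _ sqbt) rc := @rho_cont j.
  apply: (rc [set y | (rect (rho i))° y]); rewrite e in si.
  exact: (open_nbhs_nbhs (conj (@open_interior _ _) si)).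
move=> /nbhs_ballP[d d0 near_bt].
have [u [v [[u0 uv v1] [near_t _]]]] := itv_around t01 d0.
pose r := (u + v) / 2.
have [ur rv] : u < r /\ r < v by rewrite /r; split; lra.
have r01 : 0 < r < 1 by apply/andP; split; lra.
have ri : (rect (rho i))° (rho j (b, r)).
  apply: near_bt; last by split; apply: wk.
  split; first exact: ballxx.
  by rewrite /ball /= distrC; apply: near_t; rewrite !ltW.
have rj : (rect (rho j))° (rho j (b, r)).
  by apply: (rect_interior (good j)) => //; apply: regb; exact: wk.
have [_ disj _ _] := markov.
by have : set0 (rho j (b, r)) by rewrite -(disj i j ij).
Qed.

Definition lengths i : set R := [set l | exists a Y, [/\ regular_vertical F rho i a,
  developing F (fun y => rho i (a, y)) 0 1 Y & l = Y 1 - Y 0]].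

(** The infimum bounds from below every crossing of R_j, on whatever vertical of
    R_j it takes place. *)
Definition height i : R := inf (lengths i).

Lemma lengths_neq0 i : lengths i !=set0.
Proof.
have [a a01 reg] := generic_vertical (good i).
have a01' : 0 <= a <= 1 by case/andP: a01 => ? ?; rewrite !ltW.
have [Y dev] := developing_exists (good i) a01' reg.
by exists (Y 1 - Y 0), a, Y.
Qed.

Lemma lengths_ge i : exists2 c, 0 < c & lbound (lengths i) c.
Proof.
have [c c0 cP] := vertical_length_ge (good i).
exists c => // _ [a [Y [[a01 reg] dev ->]]].
have a01' : 0 <= a <= 1 by case/andP: a01 => ? ?; rewrite !ltW.
exact: cP dev.
Qed.

Lemma height_gt0 i : 0 < height i.
Proof.
have [c c0 cP] := lengths_ge i; apply: lt_le_trans c0 _.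
by apply: lb_le_inf => //; exact: lengths_neq0.
Qed.

Lemma height_le i l : lengths i l -> height i <= l.
Proof. by move=> il; apply: ge_inf => //; have [c _ cP] := lengths_ge i; exists c. Qed.

(** The image of a vertical of R_i has lambda times its length and crosses R_j
    along a full vertical for each transition; these crossings come from
    intervals with disjoint interiors. *)
Lemma crossing_sum i l : lengths i l ->
  \sum_(j | `[< transition f rho i j >]) height j <= lambda * l.
Proof.
move=> [a [Y [reg dev ->]]]; have [inc isom] := dev.
have ex j : exists c : R * (R -> R), transition f rho i j ->
    regular_vertical F rho j c.1 /\ forall t, 0 <= t <= 1 ->
      0 <= c.2 t <= 1 /\ rho j (c.1, t) = f (rho i (a, c.2 t)).
  have [ij|nij] := pselect (transition f rho i j); last by exists (0, id).
  by have [a' [tau [? ?]]] := vertical_crossing hS pA markov reg ij; exists (a', tau).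
have [c cP] := choice ex.
pose tau j := (c j).2.
pose u j := Num.min (tau j 0) (tau j 1); pose v j := Num.max (tau j 0) (tau j 1).
have Y_le x y : 0 <= x -> x <= y -> y <= 1 -> Y x <= Y y.
  move=> x0; rewrite le_eqVlt => /predU1P[->//|xy] y1; exact/ltW/inc.
have uv01 j : transition f rho i j -> [/\ 0 <= u j, u j <= v j & v j <= 1].
  move=> /cP[regj tauP].
  have [/andP[? ?] _] := tauP 0 (introT andP (conj (lexx _) ler01)).
  have [/andP[? ?] _] := tauP 1 (introT andP (conj ler01 (lexx _))).
  by rewrite /u /v le_min ge_max -/(tau j) ; split; first [exact/andP | by rewrite ge_min le_max lexx].
have hj j : transition f rho i j -> height j <= lambda * (Y (v j) - Y (u j)).
  move=> ij; have [regj tauP] := cP j ij; have [u0 uv v1] := uv01 j ij.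
  have [e devj] := developing_image hS pA markov reg regj tauP dev.
  apply: height_le; exists (c j).1, (fun t => (-1) ^+ e * (lambda * Y (tau j t))).
  split => //.
  have := devj.1 0 1 (lexx _) ltr01 (lexx _).
  rewrite -/(tau j).
  have [/andP[t00 t01] _] := tauP 0 (introT andP (conj (lexx _) ler01)).
  have [/andP[t10 t11] _] := tauP 1 (introT andP (conj ler01 (lexx _))).
  have [tt|/ltW tt] := leP (tau j 0) (tau j 1).
    have := Y_le _ _ t00 tt t11; rewrite -(ler_pM2l lambda_gt0) /u /v (min_idPl tt) (max_idPr tt).
    by case: e {devj} => /=; rewrite ?mulN1r ?mul1r !mulrBr; lra.
  have := Y_le _ _ t10 tt t01; rewrite -(ler_pM2l lambda_gt0) /u /v (min_idPr tt) (max_idPl tt).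
  by case: e {devj} => /=; rewrite ?mulN1r ?mul1r !mulrBr; lra.
apply: (@le_trans _ _ (\sum_(j | `[< transition f rho i j >]) lambda * (Y (v j) - Y (u j)))).
  by apply: ler_sum => j /asboolP/hj.
rewrite -mulr_sumr ler_pM2l//; apply: sum_disjoint_le.
- exact: Y_le.
- move=> j /asboolP/uv01[u0 uv v1]; split; apply: Y_le => //; first exact: le_trans v1.
  exact: le_trans uv.
- move=> j k /asboolP ij /asboolP ik jk.
  have [uj0 uvj vj1] := uv01 j ij; have [uk0 uvk vk1] := uv01 k ik.
  have [vu|uv] := leP (v j) (u k); first by left; apply: Y_le => //; [exact: le_trans uvj|exact: le_trans vk1].
  have [vu'|uv'] := leP (v k) (u j); first by right; apply: Y_le => //; [exact: le_trans uvk|exact: le_trans vj1].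
  exfalso.
  have [regj tauj] := cP j ij; have [regk tauk] := cP k ik.
  have ltuv n : transition f rho i n -> u n < v n.
    move=> inn; have [regn taun] := cP n inn.
    have [_ le_uv _] := uv01 n inn; rewrite lt_neqAle le_uv andbT.
    apply/eqP; rewrite /u /v => e.
    have : tau n 0 = tau n 1 by move: e; case: leP => // _ ->.
    move/(@tau_inj _ _ _ _ _ _ markov _ _ _ _ (tau n) regn taun); rewrite !in_itv /= !lexx !ler01 => /(_ isT isT)/esym/eqP.
    by rewrite oner_eq0.
  (* If the two intervals overlapped, the image of their common point x would be
     on a vertical of R_j and on one of R_k. *)
  pose x := (Num.max (u j) (u k) + Num.min (v j) (v k)) / 2.
  have lx : Num.max (u j) (u k) < Num.min (v j) (v k).
    by rewrite gt_max !lt_min !ltuv// uv uv'.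
  have [x1 x2] : Num.max (u j) (u k) < x /\ x < Num.min (v j) (v k).
    by rewrite /x; split; lra.
  move: x1 x2; rewrite gt_max lt_min => /andP[ujx ukx] /andP[xvj xvk].
  have [s s01 sx] : exists2 s, 0 < s < 1 & tau j s = x.
    by apply: (tau_itv hS markov reg regj tauj); rewrite ujx.
  have [t t01 tx] : exists2 s, 0 < s < 1 & tau k s = x.
    by apply: (tau_itv hS markov reg regk tauk); rewrite ukx.
  have wk (r : R) : 0 < r < 1 -> 0 <= r <= 1 by move=> /andP[? ?]; rewrite !ltW.
  apply: (@verticals_disjoint j k (c j).1 (c k).1 s t jk regj regk s01 (wk _ t01)).
  have [_ ->] := tauj s (wk _ s01); have [_ ->] := tauk t (wk _ t01).
  by rewrite -/(tau j) -/(tau k) sx tx.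
Qed.

Lemma height_sub i : \sum_(j | `[< transition f rho i j >]) height j <= lambda * height i.
Proof.
rewrite mulrC -ler_pdivrMr//; apply: lb_le_inf; first exact: lengths_neq0.
by move=> l il; rewrite ler_pdivrMr// mulrC; exact: crossing_sum.
Qed.

End Heights.

(** * Row sums of the coding matrix *)

Section RowSums.
Context {R : realType} {S L : topologicalType} (q : L -> S) (h : homeo L L)
  (f : homeo S S) (ft : homeo L L) (F : bifoliation R S) (lambda : R)
  (m : nat) (rho : 'I_m -> R * R -> S) (R0 : 'I_m -> set L).
Hypotheses (hS : hausdorff_space S) (connL : connected [set: L])
  (cover : regular_Z_cover q h) (pA : pseudo_anosov F lambda f)
  (lift : is_lift q f ft) (markov : markov_partition F f rho)
  (lifted : lifted_rectangles q rho R0).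

Lemma covering_open (x : L) (A : set L) : nbhs x A -> nbhs (q x) (q @` A).
Proof.
have [[_ _ ev] _ _ _] := cover; move=> xA.
have [U [sheets [oU Us qU _ homeo_sheets]]] := ev (q x).
have : (q @^-1` U) x by [].
rewrite qU => -[V sV Vx]; have [[oV _ _ open_q] _] := homeo_sheets _ sV.
have oVA : open (V `&` A°) by apply: openI => //; exact: open_interior.
have : nbhs (q x) (q @` (V `&` A°)).
  by apply: open_nbhs_nbhs; split; [apply: open_q => // y []|exists x].
by apply: filterS => _ [y [_ /interior_subset Ay] <-]; exists y.
Qed.

Lemma lifted_rect_image a : q @` (lifted_rect h R0 a) = rect (rho a.1).
Proof.
have [/(_ a.1)[_ bij] _] := lifted.
have -> : rect (rho a.1) = q @` R0 a.1.
  by case: bij => maps _ surj; apply/seteqP; split => // s [x Rx <-]; exact: maps.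
rewrite /lifted_rect image_comp; apply: eq_imagel => x _ /=.
exact: (q_zpow cover).
Qed.

Lemma interior_project a x : (lifted_rect h R0 a)° x -> (rect (rho a.1))° (q x).
Proof. by move=> /covering_open; rewrite lifted_rect_image. Qed.

Let edge (a b : 'I_m * int) :=
  (ft @` (lifted_rect h R0 a)°) `&` (lifted_rect h R0 b)° !=set0.

Lemma edge_transition a b : edge a b -> transition f rho a.1 b.1.
Proof.
move=> [_ [[x xa <-] xb]]; exists (q x); split; first exact: interior_project.
by rewrite -lift; exact: interior_project.
Qed.

(** Two points x and y of the rectangle are joined in it by a piece of the vertical
    of x followed by the horizontal of y, and the image of this connected set
    stays in one rectangle.  So its lift stays in one sheet. *)
Lemma edge_unique a b b' : edge a b -> edge a b' -> b.1 = b'.1 -> b = b'.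
Proof.
move: a b b' => [i j] [i' j'] [i'' j''] /= E1 E2 e; subst i''; congr (_, _).
have [_ [[x xa <-] xb]] := E1; have [_ [[y ya <-] yb]] := E2.
have good k : good_birectangle F (rho k) by case: markov.
have [xi yi] := (interior_project xa, interior_project ya); rewrite /= in xi yi.
have xj := interior_project xb; have yj := interior_project yb; rewrite /= !lift in xj yj.
have [[a b] sqx ex] := interior_subset xi.
have [[c d] sqy ey] := interior_subset yi.
have [[a' b'] sqx' ex'] := interior_subset xj.
have [[c' d'] sqy' ey'] := interior_subset yj.
have st s := stable_image (s := s) markov yi yj (esym ey) (esym ey') sqy sqy'.
pose V := (fun s => homeo_inv f (rho i' (a', s))) @` `[0, 1].
pose W := (fun s => rho i (s, d)) @` `[0, 1].
have [[/= a01 b01] [/= c01 d01]] := (sqx, sqy).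
have a'01 : 0 <= a' <= 1 by case: sqx'.
have pre s := unstable_preimage (s := s) markov xi xj (esym ex) (esym ex') sqx sqx'.
have Vx : V (q x).
  by exists b'; [rewrite /= in_itv /=; case: sqx'|rewrite ex' homeo_funK].
have Wy : W (q y) by exists c; rewrite ?ey//= in_itv.
have VW : (V `&` W) (rho i (a, d)).
  split; last by exists a => //; rewrite /= in_itv.
  have [s' s'01 es'] := st a a01.
  have [|t t01 et] := unstable_image (s := d) markov xi xj (esym ex) (esym ex') sqx sqx' d01.
    by rewrite es'; exists (s', d') => //; split => //=; case: sqy'.
  by exists t; [rewrite /= in_itv|rewrite -et homeo_funK].
have connK : connected (V `|` W).
  apply: connectedU; first by exists (rho i (a, d)).
    apply: connected_continuous_connected; first exact: segment_connected.
    apply: (@within_comp R S S `[0, 1]%classic setT (fun s => rho i' (a', s)) (homeo_inv f)) => //.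
      exact: (vertical_continuous (good i')).
    exact/continuous_subspaceT/homeo_inv_cont.
  apply: connected_continuous_connected; first exact: segment_connected.
  exact: (horizontal_continuous (good i)).
apply: (@lifted_rect_unique R L S q h f ft m rho R0 i i' j j' j'' (V `|` W) x y) => //.
- by move=> k; case: (good k).
- by move=> k; case: (good k).
- by case: lifted.
- move=> p [[s + <-]|[s + <-]]; rewrite /= in_itv /= => s01.
    by have [t t01 <-] := pre s s01; rewrite homeo_funK; exists (a, t).
  by exists (s, d).
- move=> p [[s + <-]|[s + <-]]; rewrite /= in_itv /= => s01.
    by rewrite homeo_invK; exists (a', s).
  by have [t t01 ->] := st s s01; exists (t, d') => //; split => //=; case: sqy'.
- by left.
- by right.
- exact: interior_subset.
- exact: interior_subset.
- exact: interior_subset.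
- exact: interior_subset.
Qed.

(** By [edge_unique], the edges from a inject in the transitions from its rectangle. *)
Lemma coding_row_sum a : (\esum_(b in [set: 'I_m * int])
    ((coding_matrix R ft h R0 a b)%:E * (height F rho b.1)%:E) <=
  (lambda * height F rho a.1)%:E)%E.
Proof.
pose H i := height F rho i.
have H0 i : (0 <= (H i)%:E)%E by rewrite lee_fin ltW//; exact: (height_gt0 markov).
have -> : (\esum_(b in [set: 'I_m * int])
    ((coding_matrix R ft h R0 a b)%:E * (H b.1)%:E) =
    \esum_(b in [set b | edge a b]) (H b.1)%:E)%E.
  rewrite [RHS]esum_mkcond; apply: eq_esum => b _; rewrite /coding_matrix.
  case: asboolP => [E|nE]; first by rewrite mul1e mem_set.
  by rewrite mul0e memNset.
rewrite -(@esum_image R _ _ [set b | edge a b] fst (fun i => (H i)%:E)); last first.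
  by move=> b b'; rewrite !inE /= => E1 E2 e; exact: (edge_unique E1 E2 e).
rewrite esum_fset; [|exact: finite_finset|by move=> j _; exact: H0].
apply: le_trans (_ : _ <= (\sum_(j | `[< transition f rho a.1 j >]) H j)%:E)%E _; last first.
  by rewrite lee_fin; exact: (height_sub hS pA markov).
rewrite -sumEFin (bigfs _ (index_enum_uniq _)); last by move=> j _; rewrite mem_index_enum.
apply: lee_fsum_nneg_subset; try exact: finite_finset.
  by move=> j /set_mem[b E <-]; apply/mem_set/asboolP; exact: (edge_transition E).
by move=> j _; exact: H0.
Qed.

End RowSums.

(** * Transience or null recurrence *)

Theorem theorem2 (R : realType) (g : nat) (S L : topologicalType)
    (q : L -> S) (h : homeo L L) (f : homeo S S) (ft : homeo L L)
    (F : bifoliation R S) (lambda : R)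
    (m : nat) (rho : 'I_m -> R * R -> S) (R0 : 'I_m -> set L) :
  (3 <= g)%N ->
  closed_surface (R := R) g S ->
  ladder_cover R q h ->
  pseudo_anosov F lambda f ->
  is_lift q f ft ->
  markov_partition F f rho ->
  lifted_rectangles q rho R0 ->
  irreducible_mx (coding_matrix R ft h R0) ->
  transient lambda (coding_matrix R ft h R0) \/
  null_recurrent lambda (coding_matrix R ft h R0).
Proof.
move=> _ [hS _] [connL cover _] pA lift markov lifted irr.
have [e [ee ft_shift]] := lift_conj_shift cover lift.
apply: (@shift_invariant_transient_or_null R 'I_m _ (fun b => height F rho b.1) lambda e) => //.
- by move=> a b; rewrite /coding_matrix; case: asboolP => _; [right|left].
- by have [l1 _ _] := pA; exact: lt_trans l1.
- by move=> b; exact: (height_gt0 markov).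
- exact: (coding_row_sum hS connL cover pA lift markov lifted).
- by move=> k c b; exact: coding_matrix_shift.
Qed.
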